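(* There is a constant $C>0$, independent of $H$ and $f$ (it may depend on $d$, $\Omega$, $\alpha$, $\beta$, $C_{I_H}$ and the shape-regularity and quasi-uniformity constants of the mesh family), such that the following holds. Let $f\in L^2(\Omega)\setminus\{0\}$ and $F(v):=\int_\Omega fv\,dx$. Let $u\in V$ solve $a(u,v)=F(v)$ for all $v\in V$ and let $u_H\in V_H$ solve $$a(u_H,(1-\mathcal C)v_H)=F(v_H)\quad\text{for all }v_H\in V_H .$$ Then $$\frac{\|u-u_H\|_{L^2(\Omega)}}{\|f\|_{L^2(\Omega)}}\le C\big(H^2+\mathbf{wcba}(A,\mathcal T_H)\big),$$ where $$\mathbf{wcba}(A,\mathcal T_H):=\sup_{g\in L^2(\Omega)\setminus\{0\}}\ \inf_{v_H\in V_H}\frac{\|u(g)-v_H\|_{L^2(\Omega)}}{\|g\|_{L^2(\Omega)}}$$ and $u(g)\in V$ denotes the solution of $a(u(g),v)=\int_\Omega gv\,dx$ for all $v\in V$.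
   Context: Let $\Omega\subseteq\mathbb R^d$, $d\in\{1,2,3\}$, be an open Lipschitz polytope. $A\in L^\infty(\Omega;\mathbb R^{d\times d})$ is symmetric with $\alpha|\xi|^2\le\xi\cdot(A(x)\xi)\le\beta|\xi|^2$ for all $\xi\in\mathbb R^d$ and a.e. $x\in\Omega$, where $0<\alpha\le\beta<\infty$. $V:=H^1_0(\Omega)$, $a(v,w):=\int_\Omega\nabla w\cdot(A\nabla v)\,dx$. Mesh: $\mathcal T_H$ is a regular (conforming) simplicial triangulation of $\Omega$ from a quasi-uniform (in particular shape-regular) family, $H:=\max_{T\in\mathcal T_H}\operatorname{diam}T$. $V_H\subseteq V$ is the space of continuous $\mathcal T_H$-piecewise affine functions in $V$. For $T\in\mathcal T_H$, $\mathsf N(T):=\operatorname{int}\big(\bigcup\{K\in\mathcal T_H: K\cap T\ne\emptyset\}\big)$. Quasi-interpolation: $I_H:V\to V_H$ is a surjective linear projection ($I_H\circ I_H=I_H$) such that for all $T\in\mathcal T_H$, $v\in V$: $H^{-1}\|v-I_Hv\|_{L^2(T)}+\|\nabla I_Hv\|_{L^2(T)}\le C_{I_H}\|\nabla v\|_{L^2(\mathsf N(T))}$ and $\|I_Hv\|_{L^2(T)}\le C_{I_H}\|v\|_{L^2(\mathsf N(T))}$, with $C_{I_H}$ independent of $H$. $W:=\ker I_H\subseteq V$. Corrector: for $v\in V$, $\mathcal Cv\in W$ is the $a$-orthogonal projection of $v$ onto $W$, i.e. $a(w,v-\mathcal Cv)=0$ for all $w\in W$. (Equivalently, for $v_H\in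 V_H$, $\mathcal Cv_H=\sum_{T\in\mathcal T_H}\sum_{j=1}^d(\partial_jv_H|_T)q_{T,j}$ with $q_{T,j}\in W$ solving $a(w,q_{T,j})=\int_T\nabla w\cdot(Ae_j)\,dx$ for all $w\in W$.) *)

(* Defs.v *)
From HB Require Import structures.
From mathcomp Require Import all_boot all_order all_algebra.
From mathcomp Require Import all_classical all_reals all_analysis.
Set Implicit Arguments.
Unset Strict Implicit.
Unset Printing Implicit Defensive.
Import Order.TTheory GRing.Theory Num.Theory.
Import numFieldNormedType.Exports.
Local Open Scope classical_set_scope.
Local Open Scope ring_scope.

(* Points of R^d are row vectors, written 'rV[R]_d.  The library norm on them
   is the sup norm, so the Euclidean structure is introduced separately; both
   induce the same topology. *)

Section Euclidean.
Context {R : realType} {d : nat}.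
Implicit Types (x y : 'rV[R]_d) (K : set 'rV[R]_d).

Definition dot x y : R := \sum_(i < d) x 0 i * y 0 i.
Definition enorm x : R := Num.sqrt (dot x x).

Definition diam K : R := sup [set enorm (p.1 - p.2) | p in K `*` K].

Definition inradius K : R :=
  sup [set r | 0 <= r /\ exists c, [set y | enorm (y - c) <= r] `<=` K].

End Euclidean.

(* Lebesgue measure on R^n: the sigma-algebra is generated by the coordinates
   (hence it is the Borel one), and the measure is the image of the n-fold
   product of the one-dimensional Lebesgue measure. *)

Definition rV_display : measure_display.
Proof. exact: default_measure_display. Qed.

Section measurable_rV.
Context {R : realType} (n : nat).

Let coors : 'I_n -> 'rV[R]_n -> measurableTypeR R := fun i x => x 0 i.

Let rV_set0 : g_sigma_preimage coors set0.
Proof. exact: sigma_algebra0. Qed.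

Let rV_setC A : g_sigma_preimage coors A -> g_sigma_preimage coors (~` A).
Proof. exact: sigma_algebraC. Qed.

Let rV_bigcup (F : _^nat) : (forall i, g_sigma_preimage coors (F i)) ->
  g_sigma_preimage coors (\bigcup_i (F i)).
Proof. exact: sigma_algebra_bigcup. Qed.

HB.instance Definition _ := @isMeasurable.Build rV_display
  'rV[R]_n (g_sigma_preimage coors) rV_set0 rV_setC rV_bigcup.

Lemma measurable_coord (i : 'I_n) :
  measurable_fun [set: 'rV[R]_n] (fun x => x 0 i : measurableTypeR R).
Proof.
move=> _ Y mY; rewrite setTI; apply: sub_sigma_algebra => /=.
rewrite -bigcup_seq/=; exists i => /=; first by rewrite mem_index_enum.
by exists Y => //; rewrite setTI.
Qed.

Lemma measurable_fun_rVP d1 (T1 : measurableType d1) (f : T1 -> 'rV[R]_n) :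
  (forall i, measurable_fun [set: T1] (fun t => f t 0 i : measurableTypeR R)) ->
  measurable_fun [set: T1] f.
Proof.
move=> mf.
have H : g_sigma_preimage (fun i t => f t 0 i : measurableTypeR R) `<=`
    (measurable : set (set T1)).
  apply: smallest_sub; first exact: sigma_algebra_measurable.
  rewrite -bigcup_seq; apply: bigcup_sub => i _ A [B mB <-]; exact: mf.
move=> _ A mA; apply: H.
rewrite (g_sigma_preimage_comp coors f); by exists A.
Qed.

End measurable_rV.

Section lebesgue_rV.
Context {R : realType}.

Definition rV_cons n (p : measurableTypeR R * 'rV[R]_n) : 'rV[R]_n.+1 :=
  \row_i oapp (p.2 0) p.1 (unlift ord0 i).

Definition rV_uncons n (x : 'rV[R]_n.+1) : measurableTypeR R * 'rV[R]_n :=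
  (x 0 ord0, \row_i x 0 (lift ord0 i)).

Lemma rV_consK n : cancel (@rV_cons n) (@rV_uncons n).
Proof.
move=> [a v]; rewrite /rV_uncons mxE unlift_none/=; congr pair.
by apply/rowP => i; rewrite !mxE liftK.
Qed.

Lemma measurable_rV_cons n : measurable_fun setT (@rV_cons n).
Proof.
apply: measurable_fun_rVP => i.
under eq_fun do rewrite mxE.
case: unliftP => [j _|_] /=; last exact: measurable_fst.
exact: (measurableT_comp (measurable_coord j) measurable_snd).
Qed.

Lemma measurable_rV_uncons n : measurable_fun setT (@rV_uncons n).
Proof.
apply: measurable_fun_pair; first exact: measurable_coord.
apply: measurable_fun_rVP => i; under eq_fun do rewrite mxE.
exact: measurable_coord.
Qed.

Section step.
Context n (m : {sigma_finite_measure set 'rV[R]_n -> \bar R}).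

Let leb1 : {sigma_finite_measure set (measurableTypeR R) -> \bar R} :=
  lebesgue_measure.

Definition lebesgue_step : set 'rV[R]_n.+1 -> \bar R :=
  pushforward (leb1 \x m)%E (@rV_cons n).

Let mE A : measurable A -> measurable (@rV_cons n @^-1` A).
Proof.
by move=> mA; rewrite -[X in measurable X]setTI; apply: measurable_rV_cons.
Qed.

Let step0 : lebesgue_step set0 = 0%E.
Proof. by rewrite /lebesgue_step /pushforward preimage_set0 measure0. Qed.

Let step_ge0 A : (0 <= lebesgue_step A)%E.
Proof. exact: (measure_ge0 (leb1 \x m)%E). Qed.

Let step_sigma_additive : semi_sigma_additive lebesgue_step.
Proof.
move=> F mF tF mUF; rewrite /lebesgue_step /pushforward preimage_bigcup.
apply: measure_semi_sigma_additive.
- by move=> k; exact: mE.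
- apply/trivIsetP => /= i j _ _ ij; rewrite -preimage_setI.
  by move/trivIsetP : tF => /(_ _ _ _ _ ij) ->//; rewrite preimage_set0.
- by rewrite -preimage_bigcup; exact: mE.
Qed.

HB.instance Definition _ := isMeasure.Build _ _ _ lebesgue_step
  step0 step_ge0 step_sigma_additive.

Let step_sigma_finite : sigma_finite setT lebesgue_step.
Proof.
have /sigma_finiteP[F [TF ndF Foo]] := sigma_finiteT leb1.
have /sigma_finiteP[G [TG ndG Goo]] := sigma_finiteT m.
exists (fun k => @rV_uncons n @^-1` (F k `*` G k)).
  rewrite -preimage_bigcup -[LHS](preimage_setT (@rV_uncons n)); congr (_ @^-1` _).
  rewrite -setXTT TF TG predeqE => -[x y]; split.
    move=> [/= [k _ Fkx] [l _ Gly]]; exists (maxn k l) => //; split.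
    - by move: x Fkx; exact/subsetPset/ndF/leq_maxl.
    - by move: y Gly; exact/subsetPset/ndG/leq_maxr.
  by move=> [k _ []/= ? ?]; split; exists k.
move=> k; have [? ?] := Foo k; have [? ?] := Goo k; split.
  rewrite -[X in measurable X]setTI; apply: measurable_rV_uncons => //.
  exact: measurableX.
rewrite /lebesgue_step /pushforward -comp_preimage.
rewrite (_ : @rV_uncons n \o @rV_cons n = id) ?preimage_id//.
  by rewrite product_measure1E// lte_mul_pinfty// ge0_fin_numE.
by apply/funext => p; exact: rV_consK.
Qed.

HB.instance Definition _ := Measure_isSigmaFinite.Build _ _ _ lebesgue_step
  step_sigma_finite.

End step.

Fixpoint lebesgue_rV n : {sigma_finite_measure set 'rV[R]_n -> \bar R} :=
  match n with
  | 0 => \d_(0 : 'rV[R]_0)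
  | n'.+1 => lebesgue_step (lebesgue_rV n')
  end.

End lebesgue_rV.
Arguments lebesgue_rV : clear implicits.

Section Sobolev.
Context {R : realType} {d : nat}.
Implicit Types (D Omega : set 'rV[R]_d) (f g : 'rV[R]_d -> R).

Local Notation leb := (lebesgue_rV R d).

Definition L2norm D f : \bar R := 'N[leb]_2%:E[(EFin \o f) \_ D].

Definition L2 D f := measurable_fun D f /\ (L2norm D f < +oo)%E.

Definition nonzero_on D f := ~ (f = cst 0 %[ae leb in D]).

Definition grad f (x : 'rV[R]_d) : 'rV[R]_d :=
  \row_i 'D_(delta_mx 0 i) f x.

Fixpoint Ck (k : nat) f : Prop :=
  continuous f /\
  if k is k'.+1 then
    forall i, (forall x, derivable f x (delta_mx 0 i)) /\
              Ck k' (fun x => grad f x 0 i)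
  else True.

Definition test_function Omega f :=
  [/\ forall k, Ck k f,
      compact (closure [set x | f x != 0]) &
      closure [set x | f x != 0] `<=` Omega].

Definition weak_gradient Omega f (g : 'rV[R]_d -> 'rV[R]_d) :=
  forall phi, test_function Omega phi -> forall i,
    \int[leb]_(x in Omega) (f x * grad phi x 0 i) =
    - \int[leb]_(x in Omega) (g x 0 i * phi x).

(* A Sobolev function v is carried together with its weak gradient, as the
   pair (v, grad v).  The second component is determined a.e. by the first, so
   this only fixes a representative of the gradient. *)
Definition sobolev := (('rV[R]_d -> R^o) * ('rV[R]_d -> 'rV[R]_d))%type.
Implicit Types v w : sobolev.

Definition gradnorm D v : \bar R := L2norm D (fun x => enorm (v.2 x)).

Definition H1 Omega v :=
  [/\ L2 Omega v.1, forall i, L2 Omega (fun x => v.2 x 0 i) &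
      weak_gradient Omega v.1 v.2].

Definition H10 Omega v :=
  H1 Omega v /\
  forall e : R, 0 < e -> exists2 phi, test_function Omega phi &
    let r : sobolev := v - (phi, grad phi) in
    (L2norm Omega r.1 < e%:E)%E /\ (gradnorm Omega r < e%:E)%E.

Definition sob_eq Omega v w :=
  v.1 = w.1 %[ae leb in Omega] /\ v.2 = w.2 %[ae leb in Omega].

End Sobolev.

Section Geometry.
Context {R : realType} {d : nat}.
Implicit Types Omega : set 'rV[R]_d.

(* The rows of P are the d + 1 vertices of a simplex; face P I is the convex
   hull of the vertices with index in I (empty for I = set0). *)
Definition face (P : 'M[R]_(d.+1, d)) (I : {set 'I_d.+1}) : set 'rV[R]_d :=
  [set x | exists w : 'rV[R]_d.+1,
    [/\ forall i, 0 <= w 0 i, forall i, i \notin I -> w 0 i = 0,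
        \sum_i w 0 i = 1 & x = w *m P]].

Definition simplex P := face P [set: 'I_d.+1]%SET.

Definition affinely_independent (P : 'M[R]_(d.+1, d)) : bool :=
  row_free (row_mx (const_mx 1 : 'cV[R]_d.+1) P).

(* Near every boundary point, Omega is the part lying strictly above the graph
   of a Lipschitz function gamma, in the direction of a unit vector e; gamma
   depends only on the component of its argument orthogonal to e. *)
Definition lipschitz_boundary Omega :=
  forall x, (closure Omega `\` interior Omega) x ->
    exists (r : R) (e : 'rV[R]_d) (gamma : 'rV[R]_d -> R) (L : R),
      [/\ 0 < r, enorm e = 1,
          forall y z, `|gamma y - gamma z| <= L * enorm (y - z),
          forall y t, gamma (y + t *: e) = gamma y &
          forall y, enorm (y - x) < r -> (Omega y <-> gamma y < dot y e)].

Definition lipschitz_polytope Omega :=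
  [/\ open Omega, lipschitz_boundary Omega &
      exists (N : nat) (S : 'I_N -> 'M[R]_(d.+1, d)),
        (forall i, affinely_independent (S i)) /\
        closure Omega = \bigcup_i simplex (S i)].

Record triangulation Omega (N : nat) (T : 'I_N -> 'M[R]_(d.+1, d)) : Prop := {
  tri_nondegenerate : forall i, affinely_independent (T i);
  tri_cover : \bigcup_i simplex (T i) = closure Omega;
  tri_conforming : forall i j, i != j ->
    exists I J : {set 'I_d.+1},
      [/\ I != [set: 'I_d.+1]%SET, J != [set: 'I_d.+1]%SET,
          simplex (T i) `&` simplex (T j) = face (T i) I &
          face (T i) I = face (T j) J]
}.

Section Mesh.
Context (N : nat) (T : 'I_N -> 'M[R]_(d.+1, d)).

Definition meshsize : R := \big[Num.max/0]_(i < N) diam (simplex (T i)).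

Definition shape_regular (sigma : R) :=
  forall i, diam (simplex (T i)) <= sigma * inradius (simplex (T i)).

Definition quasi_uniform (kappa : R) :=
  forall i, meshsize <= kappa * diam (simplex (T i)).

Definition element_patch (i : 'I_N) : set 'rV[R]_d :=
  interior (\bigcup_(j in [set j | simplex (T j) `&` simplex (T i) !=set0])
    simplex (T j)).

End Mesh.
End Geometry.

Section Problem.
Context {R : realType} {d : nat}.
Variable Omega : set 'rV[R]_d.
Implicit Types (v w : @sobolev R d) (f g : 'rV[R]_d -> R).

Local Notation leb := (lebesgue_rV R d).

(* Vectors being rows, A xi is written xi *m A^T. *)
Record coefficient (alpha beta : R) (A : 'rV[R]_d -> 'M[R]_d) : Prop := {
  coef_measurable : forall i j, measurable_fun Omega (fun x => A x i j);
  coef_bounded : exists M : R,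
    {ae leb, forall x, Omega x -> forall i j, `|A x i j| <= M};
  coef_sym : {ae leb, forall x, Omega x -> (A x)^T = A x};
  coef_elliptic : {ae leb, forall x, Omega x -> forall xi : 'rV[R]_d,
    alpha * enorm xi ^+ 2 <= dot xi (xi *m (A x)^T) <= beta * enorm xi ^+ 2}
}.

Definition aform (A : 'rV[R]_d -> 'M[R]_d) v w : R :=
  \int[leb]_(x in Omega) dot (w.2 x) (v.2 x *m (A x)^T).

Definition load f v : R := \int[leb]_(x in Omega) (f x * v.1 x).

Definition weak_solution A f u :=
  H10 Omega u /\ forall v, H10 Omega v -> aform A u v = load f v.

(* xget only selects a representative: the solution is unique up to a.e.
   equality.  The same applies to the corrector below. *)
Definition sol A g : sobolev := xget 0 [set u | weak_solution A g u].

Section Discrete.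
Context (N : nat) (T : 'I_N -> 'M[R]_(d.+1, d)).

Definition P1space v :=
  H10 Omega v /\
  exists p : 'rV[R]_d -> R,
    [/\ {within closure Omega, continuous p},
        forall i, exists (a : 'rV[R]_d) (b : R),
          forall x, simplex (T i) x -> p x = dot a x + b &
        v.1 = p %[ae leb in Omega]].

Record quasi_interpolation (CI : R) (IH : sobolev -> sobolev) : Prop := {
  qi_range : forall v, H10 Omega v -> P1space (IH v);
  qi_compat : forall v w, H10 Omega v -> H10 Omega w ->
    sob_eq Omega v w -> sob_eq Omega (IH v) (IH w);
  qi_linear : forall (c : R) v w, H10 Omega v -> H10 Omega w ->
    sob_eq Omega (IH (c *: v + w)) (c *: IH v + IH w);
  qi_surjective : forall vH, P1space vH ->
    exists2 v, H10 Omega v & sob_eq Omega (IH v) vH;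
  qi_projection : forall v, H10 Omega v -> sob_eq Omega (IH (IH v)) (IH v);
  qi_H1_stable : forall i v, H10 Omega v ->
    ((meshsize T)^-1%:E * L2norm (simplex (T i)) (v - IH v)%R.1
       + gradnorm (simplex (T i)) (IH v)
     <= CI%:E * gradnorm (element_patch T i) v)%E;
  qi_L2_stable : forall i v, H10 Omega v ->
    (L2norm (simplex (T i)) (IH v).1 <= CI%:E * L2norm (element_patch T i) v.1)%E
}.

Definition kerI (IH : sobolev -> sobolev) v :=
  H10 Omega v /\ sob_eq Omega (IH v) 0.

Definition corrector A IH v : sobolev :=
  xget 0 [set c | kerI IH c /\ forall w, kerI IH w -> aform A w (v - c) = 0].

Definition discrete_solution A IH f uH :=
  P1space uH /\
  forall vH, P1space vH -> aform A uH (vH - corrector A IH vH) = load f vH.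

Definition wcba A : \bar R :=
  ereal_sup [set ereal_inf [set (L2norm Omega (sol A g - vH)%R.1 /
                                 L2norm Omega g)%E | vH in P1space]
            | g in [set g | L2 Omega g /\ nonzero_on Omega g]].

End Discrete.
End Problem.

(* Main.v *)
(** Write [C] for the corrector, [I] for the quasi-interpolation, [e = u_H - I u]
and [|.|] for the L^2 norm.  Since [v - I v] lies in [W = ker I] and [C] is the
[a]-orthogonal projection onto [W], [a(e, (1 - C) v_H) = F(C v_H)] for every
[v_H].  Functions of [W] satisfy [|w| <= c H |grad w|]; with [v_H = e] and the
stability of [I] this gives [|grad e| <= c H |f|].  Let [z] solve
[a(z, v) = (e, v)].  Then [|e|^2 = a(z, C e) + a(I z, (1 - C) e)], the first
term is [(e, C e)], at most [c H^2 |f| |e|], and by symmetry the second one is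
[a(e, (1 - C) I z) = F(C I z) = F(C z) - F(z - I z)], at most
[c H^2 |f| |e| + |f| |z - I z|].  Finally [I] is an L^2-stable projection, so that
[|u - I u|] and [|z - I z|] are quasi-optimal, hence bounded by the
worst-case best-approximation error. *)

Require Import Defs.
From mathcomp Require Import all_boot all_order all_algebra.
From mathcomp Require Import all_classical all_reals all_analysis.
From mathcomp Require Import measurable_realfun ring lra.
Set Implicit Arguments.
Unset Strict Implicit.
Unset Printing Implicit Defensive.
Import Order.TTheory GRing.Theory Num.Theory.
Import numFieldNormedType.Exports.
Local Open Scope classical_set_scope.
Local Open Scope ring_scope.

(** * Positive semidefinite forms *)

(** The corrector and the solutions [u(g)] are given by [xget], which returns 0 when nothing
    satisfies its predicate, so their existence is part of the proof: it takes a Friedrichs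
    inequality, the completeness of [H10] and of ker I, and a Riesz theorem. As functions are not
    identified almost everywhere, all of this runs with semidefinite forms, and each change of
    representative needs an argument that the difference is invisible to the norm or load at hand.

    The bounds on I are local, the estimate is global. Summing them needs a bound, independent of H,
    on the number of patches containing a point; shape regularity and quasi-uniformity give it by
    packing inscribed balls. The patches must also stay inside [Omega], where the Lipschitz boundary
    excludes slits.

    With K the overlap and [c2 = CI^2 K], I is bounded by [sqrt c2] in L^2 and for gradients, hence
    by [sqrt (beta c2 / alpha)] in energy, and functions of W satisfy [|w| <= H sqrt (c2 / alpha)]
    times their energy norm. The best-approximation error enters twice, through u and through z,
    hence the factor 2 in [error_const]. *)

Section PsdForm.
Context {R : realType} {E : lmodType R}.
Variables (P : E -> Prop) (b : E -> E -> R).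

Definition submodule (Q : E -> Prop) :=
  Q 0 /\ forall c u v, Q u -> Q v -> Q (c *: u + v).

(* Functions equal almost everywhere are not identified, so spaces are
   predicates and scalar products are only semidefinite. *)
Record psd_form : Prop := PsdForm {
  psd_sub : submodule P;
  psd_sym : forall u v, P u -> P v -> b u v = b v u;
  psd_lin : forall c u v w, P u -> P v -> P w ->
    b (c *: u + v) w = c * b u w + b v w;
  psd_ge0 : forall u, P u -> 0 <= b u u }.

Hypothesis bP : psd_form.

Definition seminorm v : R := Num.sqrt (b v v).

Lemma psd0 : P 0. Proof. exact: (psd_sub bP).1. Qed.

Lemma psdZD c u v : P u -> P v -> P (c *: u + v).
Proof. exact: (psd_sub bP).2. Qed.

Lemma psdD u v : P u -> P v -> P (u + v).
Proof. by move=> Pu Pv; rewrite -[u]scale1r; apply: psdZD. Qed.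

Lemma psdB u v : P u -> P v -> P (u - v).
Proof. by move=> Pu Pv; rewrite addrC -scaleN1r; apply: psdZD. Qed.

Lemma psdZ c u : P u -> P (c *: u).
Proof. by move=> Pu; rewrite -[_ *: _]addr0; apply: psdZD => //; apply: psd0. Qed.

Lemma formDl u v w : P u -> P v -> P w -> b (u + v) w = b u w + b v w.
Proof.
by move=> Pu Pv Pw; rewrite -[u in LHS]scale1r (psd_lin bP)// mul1r.
Qed.

Lemma formBl u v w : P u -> P v -> P w -> b (u - v) w = b u w - b v w.
Proof.
move=> Pu Pv Pw; rewrite addrC -scaleN1r (psd_lin bP)//.
by rewrite mulN1r addrC.
Qed.

Lemma formZl c u w : P u -> P w -> b (c *: u) w = c * b u w.
Proof.
move=> Pu Pw; have P0 := psd0.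
rewrite -[c *: u]addr0 (psd_lin bP)//.
have -> : b 0 w = 0; last by rewrite addr0.
by have /eqP := formBl Pw Pw Pw; rewrite subrr subrr => /eqP.
Qed.

Lemma form0l w : P w -> b 0 w = 0.
Proof. by move=> Pw; rewrite -(scale0r w) formZl// mul0r. Qed.

Lemma formDr u v w : P u -> P v -> P w -> b w (u + v) = b w u + b w v.
Proof.
by move=> Pu Pv Pw; rewrite !(psd_sym bP Pw)// ?formDl//; apply: psdD.
Qed.

Lemma formBr u v w : P u -> P v -> P w -> b w (u - v) = b w u - b w v.
Proof.
by move=> Pu Pv Pw; rewrite !(psd_sym bP Pw)// ?formBl//; apply: psdB.
Qed.

Lemma formZr c u w : P u -> P w -> b w (c *: u) = c * b w u.
Proof.
by move=> Pu Pw; rewrite !(psd_sym bP Pw)// ?formZl//; apply: psdZ.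
Qed.

Lemma form_sqrB u v : P u -> P v ->
  b (u - v) (u - v) = b u u - b u v *+ 2 + b v v.
Proof.
move=> Pu Pv; have Puv := psdB Pu Pv.
rewrite formBl// !formBr// (psd_sym bP Pv Pu); ring.
Qed.

Lemma form_sqrD u v : P u -> P v ->
  b (u + v) (u + v) = b u u + b u v *+ 2 + b v v.
Proof.
move=> Pu Pv; have Puv := psdD Pu Pv.
rewrite formDl// !formDr// (psd_sym bP Pv Pu); ring.
Qed.

Lemma form_parallelogram u v : P u -> P v ->
  b (u - v) (u - v) + b (u + v) (u + v) = b u u *+ 2 + b v v *+ 2.
Proof. by move=> Pu Pv; rewrite form_sqrB// form_sqrD//; ring. Qed.

Lemma form_sqrZD_le c u v : P u -> P v ->
  b (c *: u + v) (c *: u + v) <= 2 * (c ^+ 2 * b u u + b v v).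
Proof.
move=> Pu Pv; have Pcu := psdZ c Pu.
have := form_parallelogram Pcu Pv; have := psd_ge0 bP (psdB Pcu Pv).
rewrite (formZl c Pu Pcu) (formZr c Pu Pu) mulrA -expr2.
move: (b _ _) (b _ _) (b _ _) (c ^+ 2 * _) => x y z t; lra.
Qed.

(** The tolerance is fitted to [form_sqrZD_le]. Applied to residuals, it combines approximations of
    two vectors into one of a linear combination. *)
Lemma form_sqrZD_lt c u v (e : R) : P u -> P v ->
  b u u < e / (2 * (c ^+ 2 + 1)) -> b v v < e / (2 * (c ^+ 2 + 1)) ->
  b (c *: u + v) (c *: u + v) < e.
Proof.
move=> Pu Pv; move: (form_sqrZD_le c Pu Pv) (psd_ge0 bP Pu) (psd_ge0 bP Pv).
move: (b u u) (b v v) (b _ _) => x y z zle x0 y0.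
have c0 := sqr_ge0 c; move: (c ^+ 2) c0 zle => k k0 zle.
have k1 : 0 < 2 * (k + 1) by lra.
rewrite !ltr_pdivlMr// => hx hy; apply: le_lt_trans zle _.
have : 0 <= x * k by rewrite mulr_ge0.
have : 0 <= y * k by rewrite mulr_ge0.
have : k * (x * (2 * (k + 1))) <= k * e by apply: ler_wpM2l => //; apply: ltW.
move=> h1 h2 h3.
rewrite -(@ltr_pM2l _ (k + 1)); last lra.
have -> : (k + 1) * (2 * (k * x + y)) = k * (x * (2 * (k + 1))) + y * (2 * (k + 1)).
  ring.
rewrite mulrDl mul1r; lra.
Qed.

Lemma form_CS2 u v : P u -> P v -> b u v ^+ 2 <= b u u * b v v.
Proof.
move=> Pu Pv.
have H t : 0 <= b u u - t * b u v *+ 2 + t ^+ 2 * b v v.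
  have := psd_ge0 bP (psdB Pu (psdZ t Pv)).
  rewrite form_sqrB//; last exact: psdZ.
  by rewrite formZr// formZl// ?formZr//; [rewrite mulrA -expr2|apply: psdZ].
have [v0|v0] := eqVneq (b v v) 0.
  rewrite v0 mulr0; have [->|uv0] := eqVneq (b u v) 0; first by rewrite expr0n.
  (* For [b v v = 0] the quadratic in [t] is affine; this [t] gives it the value [- b u u - 2 < 0],
     so [b u v] must vanish. This replaces definiteness. *)
  have := H ((b u u + 1) / b u v).
  rewrite v0 mulr0 addr0 divfK// => h.
  have := psd_ge0 bP Pu; lra.
have v_gt0 : 0 < b v v by rewrite lt_def v0 psd_ge0.
have := H (b u v / b v v).
have -> : b u u - b u v / b v v * b u v *+ 2 + (b u v / b v v) ^+ 2 * b v v =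
  (b u u * b v v - b u v ^+ 2) / b v v by field.
by rewrite pmulr_lge0 ?invr_gt0// subr_ge0.
Qed.

Lemma seminorm_ge0 v : 0 <= seminorm v. Proof. exact: sqrtr_ge0. Qed.

Lemma seminormE v : P v -> seminorm v ^+ 2 = b v v.
Proof. by move=> Pv; rewrite sqr_sqrtr// psd_ge0. Qed.

Lemma form_CS u v : P u -> P v -> `|b u v| <= seminorm u * seminorm v.
Proof.
move=> Pu Pv; rewrite -(@ler_pXn2r _ 2)// ?nnegrE// ?mulr_ge0 ?seminorm_ge0//.
by rewrite exprMn !seminormE// real_normK ?num_real// form_CS2.
Qed.

Lemma seminormD u v : P u -> P v -> seminorm (u + v) <= seminorm u + seminorm v.
Proof.
move=> Pu Pv; rewrite -(@ler_pXn2r _ 2)// ?nnegrE// ?addr_ge0 ?seminorm_ge0//.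
rewrite seminormE; last exact: psdD.
rewrite form_sqrD// sqrrD !seminormE// lerD2r lerD2l lerMn2r/=.
exact: le_trans (ler_norm _) (form_CS Pu Pv).
Qed.

Lemma seminormZ c u : P u -> seminorm (c *: u) = `|c| * seminorm u.
Proof.
move=> Pu; rewrite /seminorm formZl// ?formZr//; last exact: psdZ.
by rewrite mulrA -expr2 sqrtrM ?sqr_ge0// sqrtr_sqr.
Qed.

Lemma seminormN u : P u -> seminorm (- u) = seminorm u.
Proof. by move=> Pu; rewrite -scaleN1r seminormZ// normrN1 mul1r. Qed.

Lemma seminormB u v : P u -> P v -> seminorm (u - v) <= seminorm u + seminorm v.
Proof.
by move=> Pu Pv; rewrite -(seminormN Pv) -scaleN1r; apply: seminormD => //; apply: psdZ.
Qed.

End PsdForm.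

Arguments seminorm {R E} b v.

Lemma psd_form_sub {R : realType} {E : lmodType R} (P Q : E -> Prop) b :
  psd_form P b -> submodule Q -> (forall v, Q v -> P v) -> psd_form Q b.
Proof.
move=> bP sQ QP; split=> //.
- by move=> u v /QP Pu /QP Pv; apply: (psd_sym bP).
- by move=> c u v w /QP Pu /QP Pv /QP Pw; apply: (psd_lin bP).
- by move=> u /QP; apply: (psd_ge0 bP).
Qed.

(** * Riesz representation for a complete semidefinite form *)

Section Riesz.
Context {R : realType} {E : lmodType R}.
Variables (W : E -> Prop) (a : E -> E -> R) (F : E -> R) (k : R).
Hypothesis aW : psd_form W a.

Definition cauchy_for (b : E -> E -> R) (x : nat -> E) :=
  forall e : R, 0 < e -> exists N, forall m n, (N <= m)%N -> (N <= n)%N ->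
    b (x m - x n) (x m - x n) < e.

Definition converges_for (b : E -> E -> R) (x : nat -> E) (l : E) :=
  forall e : R, 0 < e -> exists N, forall n, (N <= n)%N ->
    b (x n - l) (x n - l) < e.

Hypothesis complete : forall x, (forall n, W (x n)) -> cauchy_for a x ->
  exists2 l, W l & converges_for a x l.
Hypothesis linF : forall c u v, W u -> W v -> F (c *: u + v) = c * F u + F v.
Hypothesis bndF : forall w, W w -> F w ^+ 2 <= k * a w w.

(* The representative is the minimiser of [J]; minimising sequences are Cauchy
   by the parallelogram identity. *)
Let J w := a w w - F w *+ 2.

Let FD u v : W u -> W v -> F (u + v) = F u + F v.
Proof. by move=> Wu Wv; rewrite -[u in LHS]scale1r linF// mul1r. Qed.

Let F0 : F 0 = 0.
Proof.
have W0 := psd0 aW.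
have := FD W0 W0; rewrite addr0 => h; lra.
Qed.

Let FZ c u : W u -> F (c *: u) = c * F u.
Proof.
by move=> Wu; rewrite -[_ *: _]addr0 linF//; [rewrite F0 addr0|apply: psd0 aW].
Qed.

Let k' := `|k| + 1.

Let bndF' w : W w -> F w ^+ 2 <= k' * a w w.
Proof.
move=> Ww; apply: le_trans (bndF Ww) _.
apply: ler_wpM2r; first exact: (psd_ge0 aW).
by rewrite /k'; have := ler_norm k; lra.
Qed.

Let k'0 : 0 < k'. Proof. by rewrite /k'; have := normr_ge0 k; lra. Qed.

(** Completing the square: [k' (a w w - 2 F w + k')] is at least [(F w - k')^2], because
    [F w ^ 2 <= k' a w w]. *)
Let J_ge w : W w -> - k' <= J w.
Proof.
move=> Ww; have h := bndF' Ww; have a0 := psd_ge0 aW Ww; rewrite /J.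
have : (F w - k') ^+ 2 >= 0 by apply: sqr_ge0.
rewrite sqrrB => h2.
have : k' * (a w w - F w *+ 2 + k') >= 0.
  have -> : k' * (a w w - F w *+ 2 + k') = k' * a w w - (F w * k' *+ 2) + k' ^+ 2.
    by ring.
  lra.
by rewrite pmulr_rge0// => ?; lra.
Qed.

Let S := [set J w | w in W].
Let infS : has_inf S.
Proof.
split; first by exists (J 0), 0 => //; apply: psd0 aW.
by exists (- k') => _ [w Ww <-]; apply: J_ge.
Qed.

Let m := inf S.

Let m_le w : W w -> m <= J w.
Proof. by move=> Ww; apply: ge_inf; [exact: infS.2|exists w]. Qed.

Lemma riesz_representation : exists2 z, W z & forall w, W w -> a z w = F w.
Proof.
have ex n : exists x, W x /\ J x < m + n.+1%:R^-1.
  have n0 : 0 < n.+1%:R^-1 :> R by rewrite invr_gt0.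
  have [_ [x Wx <-] Hx] := inf_adherent n0 infS.
  by exists x.
have [x Hx] := choice ex.
have Wx n : W (x n) by case: (Hx n).
have small (e : R) : 0 < e -> exists N, forall n, (N <= n)%N -> n.+1%:R^-1 < e.
  move=> e0; exists (Num.truncn e^-1) => n Nn.
  rewrite invf_plt ?posrE//; apply: (lt_le_trans (truncnS_gt _)).
  by rewrite ler_nat ltnS.
have Cx : cauchy_for a x.
  move=> e e0; have [N HN] := small (e / 4) ltac:(by rewrite divr_gt0).
  exists N => i j Ni Nj.
  have Wij := psdD aW (Wx i) (Wx j).
  (* Minimality at the midpoint: [a (x i - x j) (x i - x j)] is [2 J (x i) + 2 J (x j)] minus four
     times [J] of the midpoint, hence below [2 / (i + 1) + 2 / (j + 1)]. This is why [e / 4] was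
     chosen. *)
  have := m_le (psdZ aW 2^-1 Wij).
  rewrite /J (formZl aW)// ?(formZr aW)//; last exact: (psdZ aW).
  rewrite FZ// FD//.
  have := form_parallelogram aW (Wx i) (Wx j).
  have [_] := Hx i; have [_] := Hx j; rewrite /J.
  have := HN _ Ni; have := HN _ Nj.
  move: (j.+1%:R^-1) (i.+1%:R^-1) => p q; lra.
have [z Wz zlim] := complete Wx Cx.
have Jz : J z <= m.
  apply/ler_addgt0Pr => e e0.
  have a0 n : 0 <= a (x n) (x n) by apply: (psd_ge0 aW).
  have bnd : exists B, 0 < B /\ forall n, a (x n) (x n) <= B.
    (* From [(F - 2 k')^2 >= 0] follows [4 F <= a + 4 k'], so that [a <= 2 J + 4 k']; and
       [J (x n) < m + 1]. *)
    exists (4 * k' + 2 * `|m| + 2); split.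
      by rewrite ltr_wpDl// addr_ge0// mulr_ge0// ltW.
    move=> n; have [_] := Hx n; rewrite /J => h.
    have : n.+1%:R^-1 <= 1 :> R by rewrite invf_le1// ler1n.
    move: (_^-1) h => p h hp.
    have h2 := bndF' (Wx n).
    have h3 : (a (x n) (x n) *+ 0 + F (x n) - k' *+ 2) ^+ 2 >= 0 by apply: sqr_ge0.
    rewrite mulr0n add0r sqrrB in h3.
    have h4 : 0 <= k' * (a (x n) (x n) - F (x n) *+ 4 + k' *+ 4).
      have -> : k' * (a (x n) (x n) - F (x n) *+ 4 + k' *+ 4) =
        k' * a (x n) (x n) - F (x n) * (k' *+ 2) *+ 2 + (k' *+ 2) ^+ 2 by ring.
      lra.
    rewrite pmulr_rge0// in h4.
    have hm := ler_norm m; lra.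
  have [B [B0 HB]] := bnd.
  have Bk : 0 < B + k' by rewrite addr_gt0.
  (* Both [a (x n) r] and [F r] have squares at most [(B + k') a r r], so this [q] keeps each within
     [e / 8]. Each counts twice in [J z]; with [a r r < e / 4] and [J (x n) < m + e / 4] the errors
     add up to [e]. *)
  pose q := (e / 8) ^+ 2 / (B + k').
  have q0 : 0 < q by rewrite divr_gt0// exprn_gt0// divr_gt0.
  have de0 : 0 < Num.min q (e / 4) by rewrite lt_min q0 divr_gt0.
  have [N1 HN1] := zlim _ de0.
  have [N2 HN2] := small (e / 4) ltac:(by rewrite divr_gt0).
  pose n := maxn N1 N2.
  have := HN1 n (leq_maxl _ _); rewrite lt_min => /andP[h1 h1'].
  have h2 := HN2 n (leq_maxr _ _).
  have [_] := Hx n; move: h1 h1' h2; move: (n.+1%:R^-1) => p h1 h1' h2 h3.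
  have [r rE] : exists r, r = x n - z by exists (x n - z).
  rewrite -rE in h1 h1'.
  have Wr : W r by rewrite rE; apply: (psdB aW).
  have rr : 0 <= a r r by apply: (psd_ge0 aW).
  have Jzx : J z = J (x n) - a (x n) r *+ 2 + F r *+ 2 + a r r.
    rewrite /J; have -> : z = x n - r by rewrite rE subKr.
    rewrite (form_sqrB aW)// -scaleN1r [x n + _]addrC linF//.
    by rewrite mulN1r; ring.
  have bound t : t ^+ 2 <= (B + k') * a r r -> `|t| <= e / 8.
    move=> pq; rewrite -(@ler_pXn2r _ 2)// ?nnegrE// ?real_normK ?num_real//; last first.
      by rewrite divr_ge0// ltW.
    apply: le_trans pq _; rewrite mulrC -ler_pdivlMr//; exact: ltW.
  have am1 : `|a (x n) r| <= e / 8.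
    apply: bound; apply: le_trans (form_CS2 aW (Wx n) Wr) _.
    by apply: ler_wpM2r => //; apply: le_trans (HB n) _; rewrite lerDl ltW.
  have am2 : `|F r| <= e / 8.
    apply: bound; apply: le_trans (bndF' Wr) _.
    by apply: ler_wpM2r => //; rewrite lerDr ltW.
  rewrite Jzx.
  move: am1 am2; rewrite !ler_norml => /andP[? ?] /andP[? ?]; move: (J (x n)) h3 => Jx h3.
  lra.
exists z => // w Ww.
pose g := a z w - F w.
have opt t : 0 <= t * g *+ 2 + t ^+ 2 * a w w.
  have := le_trans Jz (m_le (psdZD aW t Ww Wz)).
  have Wtw := psdZ aW t Ww.
  rewrite /J linF// (form_sqrD aW)// (formZl aW t Ww Wz) (formZl aW t Ww Wtw).
  by rewrite (formZr aW t Ww Ww) (psd_sym aW Ww Wz) /g => h; lra.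
suff : g = 0 by rewrite /g => /eqP; rewrite subr_eq0 => /eqP.
have aw := psd_ge0 aW Ww.
(* This [t] makes the left side a negative multiple of [g ^+ 2]; the [+ 1] guards against
   [a w w = 0]. *)
have := opt (- g / (a w w + 1)).
have -> : - g / (a w w + 1) * g *+ 2 + (- g / (a w w + 1)) ^+ 2 * a w w =
  - (g ^+ 2 * (a w w + 2) / (a w w + 1) ^+ 2) by field; lra.
rewrite oppr_ge0 => h.
have : g ^+ 2 * (a w w + 2) <= 0.
  by move: h; rewrite pmulr_lle0// invr_gt0 exprn_gt0//; lra.
rewrite pmulr_lle0; last by lra.
by move=> h0; apply/eqP; rewrite -sqrf_eq0 eq_le h0 sqr_ge0.
Qed.

End Riesz.

(** * The error estimate in abstract spaces *)

Section AbstractEstimate.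
Context {R : realType} {E : lmodType R}.
Variables (V W VH : E -> Prop) (a m : E -> E -> R) (I C : E -> E).
Variables (p K nf : R) (F : E -> R).
Hypothesis aV : psd_form V a.
Hypothesis mV : psd_form V m.
Hypothesis sW : submodule W.
Hypothesis sVH : submodule VH.
Hypothesis WV : forall w, W w -> V w.
Hypothesis VHV : forall v, VH v -> V v.
Hypothesis p0 : 0 <= p.
Hypothesis K0 : 0 <= K.
Hypothesis nf0 : 0 <= nf.
Hypothesis W_small : forall w, W w -> seminorm m w <= p * seminorm a w.
Hypothesis IVH : forall v, V v -> VH (I v).
Hypothesis IW : forall v, V v -> W (v - I v).
Hypothesis I_stable : forall v w, VH v -> W w ->
  seminorm a v <= K * seminorm a (v - w).
Hypothesis C_W : forall v, V v -> W (C v).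
Hypothesis C_orth : forall v w, V v -> W w -> a w (v - C v) = 0.
Hypothesis linF : forall c u v, V u -> V v -> F (c *: u + v) = c * F u + F v.
Hypothesis bndF : forall v, V v -> `|F v| <= nf * seminorm m v.
Variables (u uH z : E).
Hypothesis Vu : V u.
Hypothesis uE : forall v, V v -> a u v = F v.
Hypothesis VHuH : VH uH.
Hypothesis uHE : forall v, VH v -> a uH (v - C v) = F v.
Hypothesis Vz : V z.
Hypothesis zE : forall v, V v -> a z v = m (uH - I u) v.

Let e := uH - I u.

Let FB x y : V x -> V y -> F (x - y) = F x - F y.
Proof. by move=> Vx Vy; rewrite addrC -scaleN1r linF// mulN1r addrC. Qed.

Let VC v : V v -> V (C v). Proof. by move=> /C_W/WV. Qed.
Let V1C v : V v -> V (v - C v). Proof. by move=> Vv; apply: (psdB aV) => //; apply: VC. Qed.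

Let VHe : VH e.
Proof.
have := sVH.2 (-1) _ _ (IVH Vu) VHuH.
by rewrite scaleN1r addrC.
Qed.

Let Ve : V e := VHV VHe.

(** Both sides equal [a (x - C x) (y - C y)], as [C x] and [C y] lie in [W], to which the values of
    [1 - C] are orthogonal. *)
Let a1C_sym x y : V x -> V y -> a x (y - C y) = a y (x - C x).
Proof.
move=> Vx Vy; have -> : a x (y - C y) = a (x - C x) (y - C y).
  by rewrite (formBl aV Vx (VC Vx) (V1C Vy)) (C_orth Vy (C_W Vx)) subr0.
rewrite (psd_sym aV (V1C Vx) (V1C Vy)).
by rewrite (formBl aV Vy (VC Vy) (V1C Vx)) (C_orth Vx (C_W Vy)) subr0.
Qed.

Let error_eq v : VH v -> a e (v - C v) = F (C v).
Proof.
move=> VHv; have Vv := VHV VHv; have V1 := V1C Vv.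
rewrite /e (formBl aV (VHV VHuH) (VHV (IVH Vu)) V1).
have -> : a (I u) (v - C v) = a u (v - C v).
  apply/eqP; rewrite eq_sym -subr_eq0 -(formBl aV Vu (VHV (IVH Vu)) V1).
  by rewrite (C_orth Vv (IW Vu)).
rewrite uHE// uE// (FB Vv (VC Vv)); ring.
Qed.

Let NC v : V v -> seminorm a (C v) ^+ 2 = a (C v) v.
Proof.
move=> Vv; rewrite (seminormE aV (VC Vv)).
have /eqP := C_orth Vv (C_W Vv).
by rewrite (formBr aV Vv (VC Vv) (VC Vv)) subr_eq0 => /eqP.
Qed.

Let NC_le v : V v -> seminorm a (C v) <= seminorm a v.
Proof.
move=> Vv; have := NC Vv; have := form_CS aV (VC Vv) Vv.
set x := seminorm a (C v); set y := seminorm a v => h1 h2.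
have x0 : 0 <= x by apply: seminorm_ge0.
have := le_trans (ler_norm _) h1; rewrite -h2 expr2.
have [->|xn0] := eqVneq x 0; first by move=> _; apply: seminorm_ge0.
by rewrite ler_pM2l// lt_def xn0.
Qed.

(** In the energy norm, [I_stable] with [w = C e] gives [|e|^2 <= K^2 |e - C e|^2], and
    orthogonality turns the right side into [K^2 F (C e)]. This is at most [K^2 nf p |C e|], and
    [|C e| <= |e|] leaves a factor [|e|] to divide by. *)
Let energy_error : seminorm a e <= K ^+ 2 * p * nf.
Proof.
set x := seminorm a e.
have x0 : 0 <= x by apply: seminorm_ge0.
have h1 : seminorm a (e - C e) ^+ 2 <= nf * (p * x).
  rewrite (seminormE aV (V1C Ve)).
  have -> : a (e - C e) (e - C e) = F (C e).
    by rewrite (formBl aV Ve (VC Ve) (V1C Ve)) (C_orth Ve (C_W Ve)) subr0 error_eq.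
  apply: le_trans (ler_norm _) _; apply: le_trans (bndF (VC Ve)) _.
  apply: ler_wpM2l => //; apply: le_trans (W_small (C_W Ve)) _.
  by apply: ler_wpM2l => //; apply: NC_le.
have h2 : x ^+ 2 <= K ^+ 2 * (nf * (p * x)).
  apply: (@le_trans _ _ ((K * seminorm a (e - C e)) ^+ 2)).
    rewrite ler_pXn2r// ?nnegrE ?mulr_ge0 ?seminorm_ge0//.
    by apply: I_stable => //; apply: C_W.
  by rewrite exprMn; apply: ler_wpM2l => //; apply: sqr_ge0.
have [->|xn0] := eqVneq x 0; first by rewrite !mulr_ge0// sqr_ge0.
rewrite -(@ler_pM2r _ x) ?lt_def ?xn0// -expr2.
by apply: le_trans h2 _; rewrite le_eqVlt; apply/orP; left; apply/eqP; ring.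
Qed.

(** The factor [|e|] stays undivided: it may vanish here, and the bound on [z - I z] obtained later
    is itself proportional to it. *)
Lemma abstract_L2_estimate :
  seminorm m e ^+ 2 <=
  nf * (seminorm m (z - I z) + (1 + K ^+ 2) * p ^+ 2 * seminorm m e).
Proof.
set s := seminorm m e.
have s0 : 0 <= s by apply: seminorm_ge0.
have VIz := VHV (IVH Vz); have V1e := V1C Ve.
have t1 : a z (C e) <= s * (p ^+ 2 * K ^+ 2 * nf).
  rewrite (zE (VC Ve)).
  apply: le_trans (ler_norm _) _; apply: le_trans (form_CS mV Ve (VC Ve)) _.
  apply: ler_wpM2l => //; apply: le_trans (W_small (C_W Ve)) _.
  apply: (@le_trans _ _ (p * (K ^+ 2 * p * nf))).
    by apply: ler_wpM2l => //; apply: le_trans (NC_le Ve) energy_error.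
  by rewrite le_eqVlt; apply/orP; left; apply/eqP; ring.
have Cz : seminorm m (C z) <= p ^+ 2 * s.
  have h1 := W_small (C_W Vz).
  set y := seminorm a (C z) in h1 *.
  have y0 : 0 <= y by apply: seminorm_ge0.
  (* In energy, [|C z|^2 = a z (C z) = m e (C z) <= s p |C z|]; [W_small] supplies the second factor
     [p]. *)
  have h2 : y ^+ 2 <= s * (p * y).
    rewrite (NC Vz) (psd_sym aV (VC Vz) Vz).
    rewrite (zE (VC Vz)).
    apply: le_trans (ler_norm _) _; apply: le_trans (form_CS mV Ve (VC Vz)) _.
    exact: ler_wpM2l.
  apply: le_trans h1 _; rewrite expr2 -mulrA; apply: ler_wpM2l => //.
  have [->|yn0] := eqVneq y 0; first by rewrite mulr_ge0.
  by rewrite -(@ler_pM2r _ y) ?lt_def ?yn0// -expr2 (mulrC p) -mulrA.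
have t2 : a z (e - C e) <= nf * (seminorm m (z - I z) + p ^+ 2 * s).
  have -> : a z (e - C e) = a (I z) (e - C e).
    apply/eqP; rewrite -subr_eq0 -(formBl aV Vz VIz V1e).
    by rewrite (C_orth Ve (IW Vz)).
  rewrite (a1C_sym VIz Ve) (error_eq (IVH Vz)).
  (* the correctors of [I z] and [z] differ by [z - I z], which lies in [W] *)
  have WzI := IW Vz; have VzI := WV WzI.
  have Vc1 := VC VIz; have Vc2 := VC Vz.
  have Vd : V (C z - (z - I z)) by apply: (psdB aV).
  pose g := C (I z) - (C z - (z - I z)).
  have Vg : V g by apply: (psdB aV).
  have Wg : W g.
    have W1 := sW.2 (-1) _ _ (C_W Vz) (C_W VIz).
    have -> : g = 1 *: (z - I z) + (-1 *: C z + C (I z)) by rewrite scale1r scaleN1r /g opprB [LHS]addrC -addrA.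
    exact: sW.2 1 _ _ WzI W1.
  (* [C] is fixed only up to null vectors, so [C (I z)] and [C z - (z - I z)] need not coincide.
     Their difference [g] has zero energy; [W_small] makes its mass zero, and [bndF] then kills
     [F g]. *)
  have ag : a g g = 0.
    have gE : g = (z - C z) - (I z - C (I z)).
      by rewrite /g (opprB (C z)) [z - I z - _]addrAC addrCA opprB.
    rewrite {2}gE (formBr aV (V1C Vz) (V1C VIz) Vg).
    by rewrite (C_orth Vz Wg) (C_orth VIz Wg) subrr.
  have mg : seminorm m g = 0.
    apply/eqP; rewrite eq_le seminorm_ge0 andbT.
    by apply: le_trans (W_small Wg) _; rewrite /seminorm ag sqrtr0 mulr0.
  have Fg : F g = 0.
    by apply/eqP; rewrite -normr_le0; apply: le_trans (bndF Vg) _; rewrite mg mulr0.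
  move: Fg; rewrite /g (FB Vc1 Vd) => /eqP; rewrite subr_eq0 => /eqP ->; rewrite (FB Vc2 VzI).
  apply: le_trans (ler_norm _) _; apply: le_trans (ler_normB _ _) _.
  rewrite addrC mulrDr lerD//; first exact: bndF.
  apply: le_trans (bndF Vc2) _; exact: ler_wpM2l.
rewrite (seminormE mV)// -zE//.
have -> : a z e = a z (e - C e) + a z (C e).
  by rewrite (formBr aV Ve (VC Ve) Vz) subrK.
apply: le_trans (lerD t2 t1) _.
by rewrite le_eqVlt; apply/orP; left; apply/eqP; ring.
Qed.

End AbstractEstimate.
(** * Square integrable functions *)

Section SquareIntegrable.
Context d {T : measurableType d} {R : realType}.
Variables (mu : {measure set T -> \bar R}) (D : set T).
Hypothesis mD : measurable D.
Implicit Types f g : T -> R.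

Definition sqint f := measurable_fun D f /\
  (\int[mu]_(x in D) (f x ^+ 2)%:E < +oo)%E.

(** A real integral, which reads as 0 when the extended one is infinite; hence the restriction to
    [sqint] in the identities below. *)
Definition ipD f g : R := \int[mu]_(x in D) (f x * g x).

Let msq f : measurable_fun D f -> measurable_fun D (fun x => (f x ^+ 2)%:E : \bar R).
Proof. by move=> mf; apply/measurable_EFinP; apply: measurable_funX. Qed.

Lemma sqintP f : sqint f <-> measurable_fun D f /\
  mu.-integrable D (fun x => (f x ^+ 2)%:E).
Proof.
split=> -[mf h]; split=> //.
  apply/integrableP; split; first exact: msq.
  by under eq_integral do rewrite gee0_abs ?lee_fin ?sqr_ge0//.
have /integrableP[_] := h.
by under eq_integral do rewrite gee0_abs ?lee_fin ?sqr_ge0//.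
Qed.

Lemma sqint_integrableM f g : sqint f -> sqint g ->
  mu.-integrable D (fun x => (f x * g x)%:E).
Proof.
move=> /sqintP[mf f2] /sqintP[mg g2].
apply: (le_integrable mD _ _ (integrableD mD f2 g2)).
  by apply/measurable_EFinP; apply: measurable_funM.
move=> x Dx /=; rewrite lee_fin [leRHS]ger0_norm ?addr_ge0 ?sqr_ge0// normrM.
have := sqr_ge0 (`|f x| - `|g x|); rewrite sqrrB !real_normK ?num_real//.
have := mulr_ge0 (normr_ge0 (f x)) (normr_ge0 (g x)); lra.
Qed.

Lemma sqint0 : sqint (0 : T -> R^o).
Proof.
split; first exact: measurable_cst.
under eq_integral do rewrite expr0n.
by rewrite integral0.
Qed.

Lemma sqintZD c f g : sqint f -> sqint g -> sqint (c *: (f : T -> R^o) + g).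
Proof.
move=> sf sg; have fg := sqint_integrableM sf sg.
move: sf sg => /sqintP[mf f2] /sqintP[mg g2]; apply/sqintP; split.
  exact/measurable_funD/mg/measurable_funM/mf.
have := integrableD mD (integrableD mD (integrableZl mD (c ^+ 2) f2) (integrableZl mD (c *+ 2) fg)) g2.
apply: eq_integrable => // x _ /=; rewrite -!EFinM -!EFinD; congr EFin.
rewrite (_ : (_ + g) x = c * f x + g x)//; ring.
Qed.

Lemma sqint_psd : psd_form (E := T -> R^o) sqint ipD.
Proof.
split.
- by split; [exact: sqint0|exact: sqintZD].
- by move=> f g _ _; apply: eq_Rintegral => x _; rewrite mulrC.
- move=> c f g h sf sg sh; rewrite /ipD -RintegralZl//; last exact: sqint_integrableM.
  rewrite -RintegralD//; last 2 first.
  + exact: (integrableZl mD c (sqint_integrableM sf sh)).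
  + exact: sqint_integrableM.
  apply: eq_Rintegral => x _; rewrite (_ : (_ + g) x = c * f x + g x)//; ring.
- by move=> f _; apply: Rintegral_ge0 => x _; rewrite -expr2 sqr_ge0.
Qed.

Lemma ipDE f : sqint f -> (ipD f f)%:E = (\int[mu]_(x in D) (f x ^+ 2)%:E)%E.
Proof.
move=> sf; rewrite /ipD /Rintegral fineK.
  by apply: eq_integral => x _; rewrite expr2.
exact/(integrable_fin_num mD)/sqint_integrableM.
Qed.

Lemma ipD_eq0 f : sqint f -> ipD f f = 0 <-> f = 0 %[ae mu in D].
Proof.
move=> sf; have [mf _] := sf; split=> [f0|f0].
  have := ipDE sf; rewrite f0 => /esym h.
  have : (\int[mu]_(x in D) `|(f x ^+ 2)%:E| = 0)%E.
    by rewrite -[RHS]h; apply: eq_integral => x _; rewrite gee0_abs// lee_fin sqr_ge0.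
  move/(ae_eq_integral_abs mu mD (msq mf)); apply: filterS => x h' /h' [] /eqP.
  by rewrite sqrf_eq0 => /eqP.
have := ipDE sf.
rewrite (ae_eq_integral (cst 0%E)) ?integral0//.
- by move=> [].
- exact: msq.
- by apply: filterS f0 => x h /h -> /=; rewrite expr0n.
Qed.

Lemma ipD_ae f f' g g' : measurable_fun D f -> measurable_fun D f' ->
  measurable_fun D g -> measurable_fun D g' ->
  f = f' %[ae mu in D] -> g = g' %[ae mu in D] -> ipD f g = ipD f' g'.
Proof.
move=> mf mf' mg mg' ff' gg'; congr fine; apply: ae_eq_integral => //.
- by apply/measurable_EFinP; apply: measurable_funM.
- by apply/measurable_EFinP; apply: measurable_funM.
- by apply: filterS2 ff' gg' => x h1 h2 Dx; rewrite h1 ?h2.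
Qed.

End SquareIntegrable.

(** * Completeness of the square integrable functions *)

Section Completeness.
Context d {T : measurableType d} {R : realType}.
Variables (mu : {measure set T -> \bar R}) (D : set T).
Hypothesis mD : measurable D.

(** The increments are at most [sqrt S / 2 ^ k], so the telescoping series converges absolutely. *)
Lemma fast_cauchy_cvg (u : nat -> R) (S : R) :
  (forall k, 4 ^+ k * (u k.+1 - u k) ^+ 2 <= S) -> cvgn u.
Proof.
move=> uS.
have S0 : 0 <= S by apply: le_trans (uS 0%N); rewrite mulr_ge0// sqr_ge0.
pose v k := u k.+1 - u k.
have cv : cvgn (series v).
  apply: normed_cvg.
  apply: (@series_le_cvg _ _ (geometric (Num.sqrt S) 2^-1)).
  - by move=> n; apply: normr_ge0.
  - by move=> n; rewrite /geometric/= mulr_ge0 ?sqrtr_ge0// exprn_ge0.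
  - move=> n; rewrite -(@ler_pXn2r _ 2)// ?nnegrE ?mulr_ge0 ?sqrtr_ge0 ?exprn_ge0 ?normr_ge0//.
    rewrite real_normK ?num_real// /geometric/= exprMn sqr_sqrtr//.
    have -> : (2^-1 ^+ n) ^+ 2 = (4 ^+ n)^-1 :> R.
      by rewrite -exprM mulnC exprM !exprVn -natrX.
    by rewrite ler_pdivlMr ?exprn_gt0// mulrC.
  - by apply: is_cvg_geometric_series; rewrite ger0_norm// invf_lt1// ltr1n.
have -> : u = (fun n => series v n + u 0%N).
  by apply/funext => n; rewrite /series/= telescope_sumr// subrK.
by apply: (cvgP (limn (series v) + u 0%N)); apply: cvgD => //; apply: cvg_cst.
Qed.

Import HBNNSimple.

(* No measurability is required: the bounds on [IH] integrate over closed
   simplices, and functions of [H10 Omega] need not be measurable on the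
   boundary of [Omega]. *)
Lemma le_integral_ge0 (A : set T) (f g : T -> \bar R) :
  (forall x, A x -> 0 <= f x)%E -> (forall x, A x -> f x <= g x)%E ->
  (\int[mu]_(x in A) f x <= \int[mu]_(x in A) g x)%E.
Proof.
move=> f0 fg.
rewrite !ge0_integralE//; last by move=> x Ax; apply: le_trans (f0 x Ax) (fg x Ax).
apply: ereal_sup_le => _ [h hf <-]; exists h => // x; apply: le_trans (hf x) _.
by rewrite /patch; case: ifPn => // xA; apply: fg; apply: set_mem.
Qed.

Lemma sqint_complete (f : nat -> T -> R^o) :
  (forall n, sqint mu D (f n)) -> cauchy_for (ipD mu D) f ->
  exists2 g, sqint mu D g & converges_for (ipD mu D) f g.
Proof.
move=> sf cf; have P := sqint_psd mu mD.
have mf n : measurable_fun D (f n) by have [] := sf n.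
have sB m n : sqint mu D (f m - f n) by apply: (psdB P).
(* The rate [8 ^ k] beats the weights [4 ^ k] used below: the weighted increments have integrals at
   most [(1/2) ^ k], hence summable. *)
have [nk Hnk] : exists nk : nat -> nat, forall k, (nk k < nk k.+1)%N /\
    forall m n, (nk k <= m)%N -> (nk k <= n)%N ->
      ipD mu D (f m - f n) (f m - f n) < (8 ^+ k)^-1.
  have ex k : exists N, forall m n, (N <= m)%N -> (N <= n)%N ->
      ipD mu D (f m - f n) (f m - f n) < (8 ^+ k)^-1.
    by apply: cf; rewrite invr_gt0 exprn_gt0.
  have [M HM] := choice ex.
  (* Summing the [(M i).+1] makes the indices strictly increasing while the [k]-th one still
     dominates [M k]. *)
  exists (fun k => (\sum_(i < k.+1) (M i).+1)%N) => k; split.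
    by rewrite [ltnRHS]big_ord_recr/= addnS ltnS leq_addr.
  have Mk : (M k <= \sum_(i < k.+1) (M i).+1)%N.
    by rewrite big_ord_recr/=; apply: leq_trans (leq_addl _ _).
  by move=> m n km kn; apply: HM; apply: leq_trans Mk _.
have nk_ge k : (k <= nk k)%N.
  by elim: k => // k IH; apply: leq_ltn_trans IH (Hnk k).1.
(* The series [S] of the [4 ^ k |g (k + 1) - g k|^2] has a finite integral, so
   that [g] converges wherever [S] is finite, i.e. almost everywhere. *)
pose g k := f (nk k).
pose w k x := (4 ^+ k * (g k.+1 x - g k x) ^+ 2)%:E : \bar R.
have w0 k x : (0 <= w k x)%E by rewrite lee_fin mulr_ge0 ?sqr_ge0 ?exprn_ge0.
have mw k : measurable_fun D (w k).
  apply/measurable_EFinP; apply: measurable_funM => //.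
  by apply: measurable_funX; apply: measurable_funB; apply: mf.
pose S x := (\sum_(k <oo) w k x)%E.
have mS : measurable_fun D S.
  apply: (ge0_emeasurable_sum (P := xpredT)) => [k x _ _|k _]; first exact: w0.
  exact: mw.
have S0 x : (0 <= S x)%E by apply: nneseries_ge0 => k _ _; apply: w0.
have iw k : (\int[mu]_(x in D) w k x <= ((1/2) ^+ k)%:E)%E.
  have -> : (\int[mu]_(x in D) w k x = (4 ^+ k * ipD mu D (g k.+1 - g k)%R (g k.+1 - g k)%R)%:E)%E.
    rewrite EFinM (ipDE mD (sB _ _)) -ge0_integralZl//.
    - by apply/measurable_EFinP; apply: measurable_funX; apply: measurable_funB; apply: mf.
    - by move=> x _; rewrite lee_fin sqr_ge0.
  rewrite lee_fin.
  have [lt_nk /(_ (nk k.+1) (nk k) (ltnW lt_nk) (leqnn _))/ltW h] := Hnk k.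
  apply: (le_trans (ler_wpM2l _ h)); first by rewrite exprn_ge0.
  by rewrite -exprVn -exprMn; apply: lerXn2r; rewrite ?nnegrE; lra.
have iS : (\int[mu]_(x in D) S x < +oo)%E.
  rewrite integral_nneseries//.
  apply: (@le_lt_trans _ _ 2%:E); last exact: ltry.
  apply: lime_le; first by apply: is_cvg_nneseries => k _ _; apply: integral_ge0.
  apply: nearW => n; rewrite /=.
  apply: (@le_trans _ _ (\sum_(0 <= k < n) ((1/2 : R) ^+ k)%:E)%E).
    by apply: lee_sum => k _; apply: iw.
  rewrite sumEFin lee_fin.
  have -> : \sum_(0 <= k < n) (1/2 : R) ^+ k = 2 * (1 - (1/2) ^+ n).
    elim: n => [|n IH]; first by rewrite big_geq// expr0 subrr mulr0.
    by rewrite big_nat_recr//= IH exprS; field.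
  have : 0 <= (1/2 : R) ^+ n by apply: exprn_ge0; lra.
  lra.
have Sint : mu.-integrable D S.
  apply/integrableP; split => //.
  by under eq_integral do rewrite gee0_abs//.
have [N [mN N0 SN]] := integrable_ae mD Sint.
pose B := D `\` N.
have mB : measurable B by apply: measurableD.
have BD : B `<=` D by move=> x [].
have cvB x : B x -> cvgn (fun k => g k x).
  move=> [Dx Nx]; apply: (@fast_cauchy_cvg _ (fine (S x))) => k.
  have Sfin : S x \is a fin_num.
    by apply: contrapT => h; apply: Nx; apply: SN => /= /(_ Dx).
  rewrite -lee_fin fineK//.
  apply: (@le_trans _ _ (\sum_(0 <= i < k.+1) w i x)%E).
    rewrite big_nat_recr//=; apply: leeDr; apply: sume_ge0 => i _; exact: w0.
  by apply: nneseries_lim_ge => i _ _; apply: w0.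
pose h x := if x \in B then limn (fun k => g k x) else 0.
have hE x : B x -> g k x @[k --> \oo] --> h x.
  by move=> Bx; rewrite /h mem_set//; apply: cvB.
have mh : measurable_fun D h.
  apply: (@measurable_fun_cvg _ _ _ D (fun k x => \1_B x * g k x)).
    by move=> k; apply: measurable_funM; [exact: measurable_indic|exact: mf].
  move=> x Dx; rewrite indicE /h; case: ifPn => xB.
    under eq_fun do rewrite mul1r.
    by apply: cvB; apply: set_mem.
  under eq_fun do rewrite mul0r.
  exact: cvg_cst.
(* Fatou along the subsequence, off the null set [N]. It yields both that [h] is square integrable
   and that [f n] converges to it. *)
have key n e : (forall m, (n <= m)%N -> ipD mu D (f m - f n) (f m - f n) <= e) ->
  (\int[mu]_(x in D) ((h x - f n x) ^+ 2)%:E <= e%:E)%E.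
  move=> He.
  have msq m : measurable_fun D (fun x => ((f m x - f n x) ^+ 2)%:E : \bar R).
    by apply/measurable_EFinP; apply: measurable_funX; apply: measurable_funB.
  rewrite (ge0_negligible_integral mN mD _ _ N0); last 2 first.
  - by apply/measurable_EFinP; apply: measurable_funX; apply: measurable_funB => //; apply: mf.
  - by move=> x _; rewrite lee_fin sqr_ge0.
  rewrite -/B.
  have -> : (\int[mu]_(x in B) ((h x - f n x) ^+ 2)%:E =
    \int[mu]_(x in B) limn_einf (fun k => ((g k x - f n x) ^+ 2)%:E))%E.
    apply: eq_integral => x /set_mem Bx.
    have cv : ((g k x - f n x) ^+ 2)%:E @[k --> \oo] --> ((h x - f n x) ^+ 2)%:E.
      apply: cvg_EFin; first exact: nearW.
      have c1 : g k x - f n x @[k --> \oo] --> h x - f n x.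
        by apply: cvgB; [exact: hE|exact: cvg_cst].
      by under eq_fun do rewrite /= expr2; rewrite expr2; apply: cvgM.
    by rewrite (cvg_limn_einf_sup cv).1.
  apply: le_trans (fatou _ _ _ _) _ => //.
  - by move=> k; apply: measurable_funS BD _ => //; apply: msq.
  - by move=> k x _; rewrite lee_fin sqr_ge0.
  rewrite limn_einf_lim.
  apply: lime_le; first exact: is_cvg_einfs.
  apply: nearW => k; apply: ge_ereal_inf.
  (* This index lies in the tail from [k] on, and its image under [nk] is at least [n], as the bound
     requires. *)
  exists (\int[mu]_(x in B) ((g (maxn k n) x - f n x) ^+ 2)%:E)%E.
    by exists (maxn k n) => //=; apply: leq_maxl.
  apply: (@le_trans _ _ (\int[mu]_(x in D) ((g (maxn k n) x - f n x) ^+ 2)%:E)%E).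
    apply: ge0_subset_integral => //; first exact: msq.
    by move=> x _; rewrite lee_fin sqr_ge0.
  have := ipDE mD (sB (nk (maxn k n)) n); rewrite /g => <-.
  by rewrite lee_fin; apply: He; apply: leq_trans (nk_ge _); apply: leq_maxr.
have sh : sqint mu D h.
  have [n0 Hn0] := cf 1 ltr01.
  have sd : sqint mu D (h - f n0).
    split; first by apply: measurable_funB => //; apply: mf.
    apply: (@le_lt_trans _ _ 1%:E); last exact: ltry.
    by apply: key => m n0m; apply/ltW/Hn0.
  have -> : h = (h - f n0) + f n0 :> (T -> R^o) by rewrite subrK.
  exact: (psdD P).
exists h => // e e0.
have [n0 Hn0] := cf (e / 2) ltac:(by rewrite divr_gt0).
exists n0 => n nn0.
have sd : sqint mu D (h - f n) by apply: (psdB P).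
apply: (@le_lt_trans _ _ (e / 2)); last lra.
rewrite -opprB -scaleN1r (formZl P)// ?(formZr P)//; last exact: (psdZ P).
rewrite mulrA mulrNN mulr1 mul1r -lee_fin ipDE//.
apply: key => m nm; apply/ltW/Hn0 => //; exact: leq_trans nm.
Qed.

End Completeness.

(** * Borel sets and boxes in R^n *)

Section LebesgueSpace.
Context {R : realType}.

Lemma rV_nbhsP n (y : 'rV[R]_n) (U : set 'rV[R]_n) :
  nbhs y U <-> exists2 e : R, 0 < e &
    forall z : 'rV[R]_n, (forall i, `|y 0 i - z 0 i| < e) -> U z.
Proof.
split=> [/nbhs_ballP[e /= e0 eU]|[e e0 eU]].
  by exists e => // z yz; apply: eU; split => // i j; rewrite ord1; apply: yz.
by apply/nbhs_ballP; exists e => // z [_ yz]; apply: eU => i; apply: yz.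
Qed.

(** The sigma-algebra is generated by the coordinates, so an open set is exhausted by countably many
    boxes: those inside it with rational centre and radius [1 / (k + 1)]. *)
Lemma open_measurable_rV n (U : set 'rV[R]_n) : open U -> measurable U.
Proof.
move=> oU.
pose B (p : 'rV[rat]_n * nat) : set 'rV[R]_n :=
  [set y | forall i, `|y 0 i - ratr (p.1 0 i)| < p.2.+1%:R^-1].
have mB p : measurable (B p).
  have -> : B p = \bigcap_(i in [set: 'I_n])
      ((fun y : 'rV[R]_n => y 0 i : measurableTypeR R) @^-1` ball (ratr (p.1 0 i) : R) p.2.+1%:R^-1).
    apply/seteqP; split => y /=.
      by move=> By i _; rewrite /ball/= distrC; apply: By.
    by move=> By i; have := By i I; rewrite /ball/= distrC.
  apply: fin_bigcap_measurable => // i _.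
  rewrite -[X in measurable X]setTI; apply: measurable_coord => //.
  exact: measurable_ball.
have -> : U = \bigcup_(p : 'rV[rat]_n * nat) (if `[< B p `<=` U >] then B p else set0).
  apply/seteqP; split => [y Uy|y [p _]]; last by case: asboolP => // BU; apply: BU.
  have /rV_nbhsP[e e0 eU] : nbhs y U by apply: open_nbhs_nbhs.
  (* Half of [e], because [y] and any other point of the box are each within one radius of the
     centre. *)
  have [k ke] : exists k, (k.+1%:R^-1 : R) < e / 2.
    exists (Num.truncn (e / 2)^-1).
    by rewrite invf_plt ?posrE ?divr_gt0//; apply: truncnS_gt.
  have k0 : 0 < k.+1%:R^-1 :> R by rewrite invr_gt0.
  have /choice[q Hq] (i : 'I_n) : exists q : rat, `|y 0 i - ratr q| < k.+1%:R^-1.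
    have : y 0 i - k.+1%:R^-1 < y 0 i + k.+1%:R^-1 by rewrite ltrD2l gtrN.
    move=> /rat_in_itvoo[q]; rewrite in_itv/= => /andP[q1 q2]; exists q.
    by rewrite ltr_norml ltrBrDl ltrBlDr q2 ltrBlDl -ltrBlDr q1.
  exists ((\row_i q i), k) => //; case: asboolP => [_|].
    by move=> i; rewrite mxE.
  case=> z Bz; apply: eU => i.
  rewrite -(subrK (ratr (q i)) (y 0 i)) -addrA (le_lt_trans (ler_normD _ _))//.
  have := Hq i; have := Bz i; rewrite mxE/= distrC => h1 h2.
  rewrite (splitr e) ltrD// (lt_trans _ ke)//.
apply: countable_bigcupT_measurable; first exact: countableP.
by move=> p; case: asboolP.
Qed.

Lemma continuous_measurable_rV n (f : 'rV[R]_n -> R) (D : set 'rV[R]_n) :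
  continuous f -> measurable D -> measurable_fun D f.
Proof.
move=> cf mD; apply: measurable_funTS.
move=> mT; apply: (measurability _ (RGenOInfty.measurableE R)) => //.
move=> _ [_ [a ->] <-].
rewrite setTI; apply: open_measurable_rV.
by move/continuousP : cf; apply; apply: interval_open.
Qed.

(** Written by coordinates, the box pulls back under [rV_cons] to an interval times the box one
    dimension lower; its finite measure follows by induction. *)
Definition rV_box n (M : R) : set 'rV[R]_n := [set x | forall i, `|x 0 i| <= M].
Arguments rV_box : clear implicits.

Lemma rV_box_measurable n (M : R) : measurable (rV_box n M).
Proof.
rewrite (_ : rV_box n M = \bigcap_(i in [set: 'I_n])
    ((fun y : 'rV[R]_n => y 0 i : measurableTypeR R) @^-1` `[-M, M])).
  apply: fin_bigcap_measurable => // i _.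
  by rewrite -[X in measurable X]setTI; apply: measurable_coord.
apply/seteqP; split => y /=.
  by move=> h i _; rewrite /= in_itv/= -ler_norml.
by move=> h i; have := h i I; rewrite /= in_itv/= -ler_norml.
Qed.

Lemma rV_box_lty n (M : R) : (lebesgue_rV R n (rV_box n M) < +oo)%E.
Proof.
elim: n => [|n IH].
  by rewrite /= diracE; case: (_ \in _) => /=; rewrite ?ltry.
rewrite /= /lebesgue_step /pushforward.
rewrite (_ : _ @^-1` _ = (`[-M, M] : set (measurableTypeR R)) `*` rV_box n M); last first.
  apply/seteqP; split => -[a v] /=.
    move=> h; split; first by have := h ord0; rewrite mxE unlift_none/= in_itv/= ler_norml.
    by move=> i; have := h (lift ord0 i); rewrite mxE liftK.
  rewrite in_itv/= -ler_norml => -[h1 h2] i; rewrite mxE.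
  by case: unliftP => [j _|_]/=.
rewrite product_measure1E//=; last exact: rV_box_measurable.
apply: lte_mul_pinfty => //.
- by rewrite lebesgue_measure_itv/=; case: ifP.
Qed.

End LebesgueSpace.

Arguments rV_box {R} n M.

Section L2norm.
Context {R : realType} {d : nat}.
Local Notation leb := (lebesgue_rV R d).
Implicit Types (D : set 'rV[R]_d) (f g : 'rV[R]_d -> R).

Lemma L2normE D f :
  L2norm D f = ((\int[leb]_(x in D) (f x ^+ 2)%:E) `^ 2^-1)%E.
Proof.
rewrite /L2norm unlock; congr poweR; rewrite [RHS]integral_mkcond.
apply: eq_integral => x _; rewrite /patch; case: ifPn => xD.
    rewrite abse_EFin.
  by rewrite poweR_EFin powR_mulrn ?normr_ge0// real_normK ?num_real.
by rewrite abse0 poweR_EFin powR0// pnatr_eq0.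
Qed.

Lemma L2P D f : measurable D -> L2 D f <-> sqint leb D f.
Proof.
move=> mD; rewrite /L2 /sqint L2normE; split=> -[mf h]; split => //.
  exact: lty_poweRy h.
exact: poweR_lty.
Qed.

Lemma L2norm_ip D f : measurable D -> sqint leb D f ->
  L2norm D f = (seminorm (E := 'rV[R]_d -> R^o) (ipD leb D) f)%:E.
Proof.
move=> mD sf; rewrite L2normE -ipDE// poweR_EFin powR12_sqrt//.
exact: (psd_ge0 (sqint_psd leb mD)).
Qed.

Lemma L2norm_ge0 D f : (0 <= L2norm D f)%E.
Proof. by rewrite L2normE poweR_ge0. Qed.

(** Rests on [le_integral_ge0], so [D'] may be a closed simplex that reaches the boundary of
    [Omega]. *)
Lemma L2norm_subset D D' f : D `<=` D' -> (L2norm D f <= L2norm D' f)%E.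
Proof.
move=> DD'; rewrite !L2normE gt0_ler_poweR//.
- by rewrite in_itv/= leey integral_ge0// => x _; rewrite lee_fin sqr_ge0.
- by rewrite in_itv/= leey integral_ge0// => x _; rewrite lee_fin sqr_ge0.
rewrite [leLHS]integral_mkcond [leRHS]integral_mkcond.
apply: le_integral_ge0 => x _; rewrite /patch.
  by case: ifP => //; rewrite lee_fin sqr_ge0.
case: ifPn => [xD|_]; last by case: ifP => //; rewrite lee_fin sqr_ge0.
by rewrite mem_set//; apply: DD'; apply: set_mem.
Qed.

Lemma L2norm_lt D f (e : R) : measurable D -> sqint leb D f -> 0 < e ->
  (L2norm D f < e%:E)%E = (ipD leb D f f < e ^+ 2).
Proof.
move=> mD sf e0; rewrite L2norm_ip// lte_fin.
rewrite -(@ltr_pXn2r _ 2)// ?nnegrE ?seminorm_ge0 ?ltW//.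
by rewrite (seminormE (sqint_psd leb mD)).
Qed.

End L2norm.

(** * Sobolev functions *)

Section SmoothFunctions.
Context {R : realType} {d : nat}.
Implicit Types (f g : 'rV[R]_d -> R) (Omega : set 'rV[R]_d).

Lemma continuous_lin (c : R) f g : continuous f -> continuous g ->
  continuous (fun x => c * f x + g x).
Proof.
move=> cf cg x.
have h1 : {for x, continuous (fun y => c * f y)}.
  by apply: (@continuousM R _ (cst c) f); [exact: cst_continuous|exact: cf].
by apply: (@continuousD R _ _ (fun y => c * f y) g); [exact: h1|exact: cg].
Qed.

Lemma continuous_coordM (i : 'I_d) f : continuous f ->
  continuous (fun x : 'rV[R]_d => x 0 i * f x).
Proof.
move=> cf x; apply: (@continuousM R _ (fun y : 'rV[R]_d => y 0 i) f).
  exact: coord_continuous.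
exact: cf.
Qed.

Lemma derive_coord (i j : 'I_d) (x : 'rV[R]_d) :
  is_derive x (delta_mx 0 j : 'rV[R]_d) (fun y : 'rV[R]_d => y 0 i : R^o) ((j == i)%:R : R^o).
Proof.
have did : derivable (@id 'rV[R]_d) x (delta_mx 0 j) by apply: derivable_id.
split; first by have /derivable_mxP/(_ 0 i) := did.
have := derive_mx did; rewrite derive_id => /matrixP/(_ 0 i).
by rewrite !mxE eqxx/= eq_sym => ->.
Qed.

Lemma CkS k f : Ck k.+1 f -> Ck k f.
Proof.
elim: k f => [|k IH] f; first by case.
by move=> [cf df]; split => // i; have [Df Cf] := df i; split => //; apply: IH.
Qed.

Lemma grad_cst0 : grad (0 : 'rV[R]_d -> R^o) = 0.
Proof.
apply/funext => x; apply/rowP => i; rewrite !mxE.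
exact: (derive_cst (0 : R^o)).
Qed.

Lemma grad_lin (c : R) f g : (forall i x, derivable f x (delta_mx 0 i)) ->
  (forall i x, derivable g x (delta_mx 0 i)) ->
  grad (fun x => c * f x + g x) = c *: grad f + grad g.
Proof.
move=> df dg; apply/funext => x; apply/rowP => i; rewrite !mxE.
have := deriveD (derivableZ (k:=c) (df i x)) (dg i x); rewrite deriveZ//.
Qed.

Lemma Ck_lin k c f g : Ck k f -> Ck k g -> Ck k (fun x => c * f x + g x).
Proof.
elim: k f g => [|k IH] f g [cf df] [cg dg].
  by split => //; apply: continuous_lin.
split; first exact: continuous_lin.
move=> i; have [Df Cf] := df i; have [Dg Cg] := dg i; split.
  by move=> x; apply: derivableD; [apply: (derivableZ (k:=c) (Df x))|exact: Dg].
have -> : (fun x => grad (fun y => c * f y + g y) x 0 i) =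
    fun x => c * grad f x 0 i + grad g x 0 i.
  have H : grad (fun y => c * f y + g y) = c *: grad f + grad g.
    by apply: grad_lin => j y; [have [D _] := df j|have [D _] := dg j]; exact: D.
  by apply/funext => x; rewrite H 2!mxE.
exact: IH.
Qed.

Lemma Ck0 k : Ck k (0 : 'rV[R]_d -> R).
Proof.
elim: k => [|k IH]; first by split => //; apply: cst_continuous.
split; first exact: cst_continuous.
move=> i; split; first by move=> x; apply: (derivable_cst (0 : R^o)).
by rewrite (_ : (fun _ => _) = 0)// grad_cst0; apply/funext => x; rewrite mxE.
Qed.

Lemma derivable_coordM (i j : 'I_d) f x : derivable f x (delta_mx 0 j) ->
  derivable (fun y : 'rV[R]_d => y 0 i * f y) x (delta_mx 0 j).
Proof.
by move=> df; apply: (derivableM (@ex_derive _ _ _ _ _ _ _ (derive_coord i j x)) df).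
Qed.

Lemma grad_coordM (i j : 'I_d) f x : derivable f x (delta_mx 0 j) ->
  grad (fun y : 'rV[R]_d => y 0 i * f y) x 0 j = (j == i)%:R * f x + x 0 i * grad f x 0 j.
Proof.
move=> df; rewrite !mxE.
have -> := deriveM (@ex_derive _ _ _ _ _ _ _ (derive_coord i j x)) df.
rewrite (@derive_val _ _ _ _ _ _ _ (derive_coord i j x)).
by rewrite addrC; congr (_ + _); rewrite mulrC.
Qed.

(** A derivative consists of [f] or 0, plus the coordinate times a derivative of [f]. The first has
    an order to spare, given up by [CkS]; the second is the induction hypothesis. *)
Lemma Ck_coordM k (i : 'I_d) f : Ck k f -> Ck k (fun x : 'rV[R]_d => x 0 i * f x).
Proof.
elim: k f => [|k IH] f [cf df].
  by split => //; apply: continuous_coordM.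
split; first exact: continuous_coordM.
move=> j; have [Df Cf] := df j; split; first by move=> x; apply: derivable_coordM.
have -> : (fun x => grad (fun y : 'rV[R]_d => y 0 i * f y) x 0 j) =
    fun x => (j == i)%:R * f x + x 0 i * grad f x 0 j.
  by apply/funext => x; rewrite grad_coordM.
apply: Ck_lin; last exact: IH.
exact: CkS.
Qed.

Lemma test_function_sub Omega f g : (forall k, Ck k g) ->
  (forall x, f x = 0 -> g x = 0) -> test_function Omega f -> test_function Omega g.
Proof.
move=> Cg fg [Cf cf fO]; have sub : closure [set x | g x != 0] `<=` closure [set x | f x != 0].
  by apply: closureS => x /=; apply: contra_neq; exact: fg.
split => //; last exact: subset_trans fO.
by apply: subclosed_compact cf sub; apply: closed_closure.
Qed.

Lemma test_function0 Omega : test_function Omega 0.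
Proof.
split; first by move=> k; apply: Ck0.
- rewrite (_ : [set _ | _] = set0) ?closure0; first exact: compact0.
  by rewrite -subset0 => x /=; rewrite eqxx.
- rewrite (_ : [set _ | _] = set0) ?closure0//.
  by rewrite -subset0 => x /=; rewrite eqxx.
Qed.

Lemma test_function_lin Omega c f g : test_function Omega f -> test_function Omega g ->
  test_function Omega (fun x => c * f x + g x).
Proof.
move=> [Cf cf fO] [Cg cg gO].
have sub : closure [set x | c * f x + g x != 0] `<=`
    closure [set x | f x != 0] `|` closure [set x | g x != 0].
  rewrite -closureU; apply: closureS => x /=.
  have [->|fx _] := eqVneq (f x) 0; last by left.
  by rewrite mulr0 add0r; right.
split; first by move=> k; apply: Ck_lin.
- apply: subclosed_compact (compactU cf cg) sub; exact: closed_closure.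
- by apply: subset_trans sub _; rewrite subUset.
Qed.

(** Makes [x_i phi] admissible in the weak gradient identity, for the Friedrichs inequality. *)
Lemma test_function_coordM Omega (i : 'I_d) f : test_function Omega f ->
  test_function Omega (fun x : 'rV[R]_d => x 0 i * f x).
Proof.
move=> tf; have [Cf _ _] := tf; apply: test_function_sub tf.
  by move=> k; apply: Ck_coordM.
by move=> x ->; rewrite mulr0.
Qed.

Lemma test_derivable Omega f i x : test_function Omega f ->
  derivable f x (delta_mx 0 i).
Proof. by move=> [/(_ 1%N)[_ /(_ i)[]]]. Qed.

Lemma test_continuous Omega f : test_function Omega f -> continuous f.
Proof. by move=> [/(_ 0%N)[]]. Qed.

Lemma test_grad_continuous Omega f i : test_function Omega f ->
  continuous (fun x => grad f x 0 i).
Proof. by move=> [/(_ 1%N)[_ /(_ i)[_ []]]]. Qed.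

End SmoothFunctions.

Section BoundedDomain.
Context {R : realType} {d : nat}.
Variables (Omega : set 'rV[R]_d) (M : R).
Hypothesis mO : measurable Omega.
Hypothesis OM : Omega `<=` rV_box d M.
Local Notation leb := (lebesgue_rV R d).

Lemma bounded_mul_sqint (h f : 'rV[R]_d -> R) (B : R) : measurable_fun Omega h ->
  (forall x, Omega x -> `|h x| <= B) -> sqint leb Omega f ->
  sqint leb Omega (fun x => h x * f x) /\
  ipD leb Omega (fun x => h x * f x) (fun x => h x * f x) <= B ^+ 2 * ipD leb Omega f f.
Proof.
move=> mh hB sf; have /sqintP[mf f2] := sf.
have mhf : measurable_fun Omega (fun x => h x * f x) by apply: measurable_funM.
have bd x : Omega x -> (h x * f x) ^+ 2 <= B ^+ 2 * f x ^+ 2.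
  move=> Ox; rewrite exprMn; apply: ler_wpM2r; first exact: sqr_ge0.
  have hx := hB x Ox; have B0 : 0 <= B := le_trans (normr_ge0 _) hx.
  by rewrite -(real_normK (num_real (h x))) lerXn2r// nnegrE.
have shf : sqint leb Omega (fun x => h x * f x).
  apply/sqintP; split => //.
  apply: (le_integrable mO _ _ (integrableZl mO (B ^+ 2) f2)).
    by apply/measurable_EFinP; apply: measurable_funX.
  move=> x Ox; rewrite /= lee_fin (ger0_norm (sqr_ge0 _)) (ger0_norm (mulr_ge0 (sqr_ge0 _) (sqr_ge0 _))).
  exact: bd.
split => //.
rewrite -lee_fin EFinM !ipDE// -(integralZl mO f2).
apply: le_integral_ge0 => x Ox; first by rewrite lee_fin sqr_ge0.
by rewrite lee_fin; apply: bd.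
Qed.

(** On the compact box around [Omega] the function is bounded, hence a bounded multiple of 1, which
    is square integrable as the box has finite measure. *)
Lemma continuous_sqint (f : 'rV[R]_d -> R) : continuous f -> sqint leb Omega f.
Proof.
move=> cf.
have mf : measurable_fun Omega f by apply: continuous_measurable_rV.
have [B HB] : exists B, forall x, Omega x -> `|f x| <= B.
  have cbox : compact (rV_box d M).
    have := @rV_compact R d (fun=> `[- M, M]%classic) (fun=> @segment_compact R (- M) M).
    congr compact; apply/seteqP; split => x /= h i; have := h i; last by rewrite in_itv/= -ler_norml.
    by rewrite in_itv/= -ler_norml.
  have := compact_bounded (continuous_compact (continuous_subspaceT cf) cbox).
  move=> [B [_ HB]]; exists (B + 1) => x Ox; apply: (HB (B + 1)); first by rewrite ltrDl.
  by exists x => //; apply: OM.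
have s1 : sqint leb Omega (cst 1).
  split => //; under eq_integral do rewrite expr1n.
  rewrite integral_cst// mul1e.
  apply: le_lt_trans (rV_box_lty d M); apply: le_measure => //; rewrite ?inE//.
  exact: rV_box_measurable.
have [+ _] := bounded_mul_sqint mf HB s1.
by under eq_fun do rewrite mulr1.
Qed.

End BoundedDomain.

Section SobolevForms.
Context {R : realType} {d : nat}.
Local Notation leb := (lebesgue_rV R d).
Implicit Types (D Omega : set 'rV[R]_d) (v w : @sobolev R d).

Definition dcomp v (i : 'I_d) : 'rV[R]_d -> R^o := fun x => v.2 x 0 i.

Definition L2sob D v := sqint leb D v.1 /\ forall i, sqint leb D (dcomp v i).

Definition mass D v w : R := ipD leb D v.1 w.1.

(** Taken by components, so that its properties reduce to those of the scalar [ipD];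
    [gradnorm_stiff] returns to the Euclidean norm of the gradient. *)
Definition stiff D v w : R := \sum_i ipD leb D (dcomp v i) (dcomp w i).

Lemma dcompZD c v w i : dcomp (c *: v + w) i = c *: dcomp v i + dcomp w i.
Proof. by apply/funext => x; rewrite /dcomp /= !mxE. Qed.

Lemma dcompB v w i : dcomp (v - w) i = dcomp v i - dcomp w i.
Proof. by apply/funext => x; rewrite /dcomp /= !mxE. Qed.

Lemma dcomp0 i : dcomp 0 i = 0.
Proof. by apply/funext => x; rewrite /dcomp /= !mxE. Qed.

Lemma L2sob_submodule D : measurable D -> submodule (L2sob D).
Proof.
move=> mD; split.
  by split=> [|i]; rewrite ?dcomp0; apply: sqint0.
move=> c u v [u1 u2] [v1 v2]; split=> [|i]; rewrite ?dcompZD.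
  exact: (sqintZD mD c u1 v1).
exact: (sqintZD mD c (u2 i) (v2 i)).
Qed.

Lemma mass_psd D : measurable D -> psd_form (L2sob D) (mass D).
Proof.
move=> mD; have P := sqint_psd leb mD; split.
- exact: L2sob_submodule.
- by move=> u v [? _] [? _]; apply: (psd_sym P).
- by move=> c u v w [? _] [? _] [? _]; apply: (psd_lin P).
- by move=> u [? _]; apply: (psd_ge0 P).
Qed.

Lemma stiff_psd D : measurable D -> psd_form (L2sob D) (stiff D).
Proof.
move=> mD; have P := sqint_psd leb mD; split.
- exact: L2sob_submodule.
- by move=> u v [_ ?] [_ ?]; apply: eq_bigr => i _; apply: (psd_sym P).
- move=> c u v w [_ ?] [_ ?] [_ ?]; rewrite /stiff mulr_sumr -big_split/=.
  by apply: eq_bigr => i _; rewrite dcompZD (psd_lin P).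
- by move=> u [_ ?]; apply: sumr_ge0 => i _; apply: (psd_ge0 P).
Qed.

Lemma L2sob_L2 D v : measurable D ->
  L2sob D v <-> L2 D v.1 /\ forall i, L2 D (fun x => v.2 x 0 i).
Proof.
by move=> mD; split=> -[v1 v2]; split=> [|i]; apply/L2P => //; apply: v2.
Qed.

Lemma L2norm_mass D v : measurable D -> L2sob D v ->
  L2norm D v.1 = (seminorm (mass D) v)%:E.
Proof. by move=> mD [v1 _]; apply: L2norm_ip. Qed.

Lemma enorm_sqint D (g : 'rV[R]_d -> 'rV[R]_d) : measurable D ->
  (forall i, sqint leb D (fun x => g x 0 i)) ->
  sqint leb D (fun x => enorm (g x)) /\
  ipD leb D (fun x => enorm (g x)) (fun x => enorm (g x)) =
  \sum_i ipD leb D (fun x => g x 0 i) (fun x => g x 0 i).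
Proof.
move=> mD sg.
have e2 x : enorm (g x) ^+ 2 = \sum_i g x 0 i ^+ 2.
  rewrite /enorm sqr_sqrtr; first by apply: eq_bigr => i _; rewrite expr2.
  by apply: sumr_ge0 => i _; rewrite -expr2 sqr_ge0.
have se : sqint leb D (fun x => enorm (g x)).
  apply/sqintP; split.
    rewrite (_ : (fun _ => _) = Num.sqrt \o (fun x => \sum_i g x 0 i ^+ 2)).
      apply: measurableT_comp; first exact: continuous_measurable_fun (@sqrt_continuous R).
      by apply: measurable_sum => i; apply: measurable_funX; case: (sg i).
    by apply/funext => x /=; rewrite -e2 sqrtr_sqr ger0_norm// sqrtr_ge0.
  under eq_fun do rewrite e2 -sumEFin.
  by apply: integrable_sum => // i _; have /sqintP[] := sg i.
split => //; apply: EFin_inj; rewrite ipDE//.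
under eq_integral do rewrite e2 -sumEFin.
rewrite integral_sum//; last by move=> i; have /sqintP[] := sg i.
by rewrite -sumEFin; apply: eq_bigr => i _; rewrite ipDE.
Qed.

Lemma gradnorm_stiff D v : measurable D -> L2sob D v ->
  gradnorm D v = (seminorm (stiff D) v)%:E.
Proof.
move=> mD [_ v2]; have [s e] := enorm_sqint mD v2.
by rewrite /gradnorm L2norm_ip// /seminorm e.
Qed.

Lemma L2sobS D D' v : measurable D -> measurable D' -> D `<=` D' ->
  L2sob D' v -> L2sob D v.
Proof.
move=> mD mD' DD' [v1 v2].
have sub (f : 'rV[R]_d -> R) : sqint leb D' f -> sqint leb D f.
  move=> /sqintP[mf f2]; apply/sqintP; split; first exact: measurable_funS mf.
  exact: integrableS f2.
by split=> [|i]; apply: sub.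
Qed.

End SobolevForms.

(** * The space [H10] in terms of forms *)

Section H10.
Context {R : realType} {d : nat}.
Variables (Omega : set 'rV[R]_d) (M : R).
Hypothesis mO : measurable Omega.
Hypothesis OM : Omega `<=` rV_box d M.
Local Notation leb := (lebesgue_rV R d).
Local Notation ip := (ipD leb Omega).
Implicit Types v w : @sobolev R d.

Let P := sqint_psd leb mO.

Lemma H10_L2sob v : H10 Omega v -> L2sob Omega v.
Proof. by move=> [[v1 v2 _] _]; apply/L2sob_L2. Qed.

Definition jet (phi : 'rV[R]_d -> R) : @sobolev R d := (phi, grad phi).

Lemma test_L2sob phi : test_function Omega phi -> L2sob Omega (jet phi).
Proof.
move=> tphi; split; first exact/(continuous_sqint mO OM)/(test_continuous tphi).
by move=> i; apply/(continuous_sqint mO OM)/(test_grad_continuous tphi).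
Qed.

(** Replaces extended-real norms by [mass] and [stiff], to which the calculus of [psd_form] applies.
    Tolerances now bound squares, whence [sqrt e] in one direction and [e ^+ 2] in the other. *)
Lemma H10P v : H10 Omega v <->
  [/\ L2sob Omega v,
    (forall phi, test_function Omega phi -> forall i,
      ip v.1 (dcomp (jet phi) i) + ip (dcomp v i) phi = 0) &
    (forall e, 0 < e -> exists2 phi, test_function Omega phi &
      mass Omega (v - jet phi) (v - jet phi) < e /\
      stiff Omega (v - jet phi) (v - jet phi) < e)].
Proof.
have sB w phi : L2sob Omega w -> test_function Omega phi -> L2sob Omega (w - jet phi).
  by move=> sw tphi; apply: (psdB (mass_psd mO)) => //; apply: test_L2sob.
have lt_norm w (e : R) : L2sob Omega w -> 0 < e ->
   ((L2norm Omega w.1 < e%:E)%E = (mass Omega w w < e ^+ 2)) *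
   ((gradnorm Omega w < e%:E)%E = (stiff Omega w w < e ^+ 2)).
  move=> sw e0; split.
    by rewrite L2norm_lt//; case: sw.
  have [s E] := enorm_sqint mO sw.2.
  by rewrite /gradnorm L2norm_lt// E.
split.
  move=> /[dup] /H10_L2sob sv [[_ _ wg] ap]; split => //.
    by move=> phi tphi i; have := wg phi tphi i; rewrite /ipD /dcomp/= => ->; rewrite addNr.
  move=> e e0; have se0 : 0 < Num.sqrt e by rewrite sqrtr_gt0.
  have [phi tphi h] := ap _ se0; exists phi => //.
  have sd := sB _ _ sv tphi.
  have [l1 l2] := lt_norm _ _ sd se0; have [h1 h2] := h.
  rewrite sqr_sqrtr ?ltW// in l1 l2.
  by split; [rewrite -l1; exact: h1|rewrite -l2; exact: h2].
move=> [sv wg ap]; have [v1 v2] := (L2sob_L2 v mO).1 sv.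
split.
  split => // phi tphi i; have /eqP := wg phi tphi i.
  by rewrite addr_eq0 => /eqP.
move=> e e0; have [phi tphi h] := ap (e ^+ 2) (exprn_gt0 _ e0); exists phi => //.
have [l1 l2] := lt_norm _ _ (sB _ _ sv tphi) e0; have [h1 h2] := h.
by split; [move: h1; rewrite -l1|move: h2; rewrite -l2].
Qed.

Lemma jet_lin c phi psi : test_function Omega phi -> test_function Omega psi ->
  jet (fun x => c * phi x + psi x) = c *: jet phi + jet psi.
Proof.
move=> tphi tpsi; congr pair.
by apply: grad_lin => i x; [exact: test_derivable tphi|exact: test_derivable tpsi].
Qed.

Lemma H10_submodule : submodule (H10 Omega).
Proof.
have mP := mass_psd mO; have sP := stiff_psd mO.
split.
  apply/H10P; split.
  - exact: (psd0 mP).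
  - move=> phi tphi i; rewrite dcomp0.
    have [t1 t2] := test_L2sob tphi.
    by rewrite (form0l P (t2 i)) (form0l P t1) addr0.
  - move=> e e0; exists 0; first exact: test_function0.
    have -> : jet 0 = 0 by congr pair; apply: grad_cst0.
    by rewrite subr0 (form0l mP (psd0 mP)) (form0l sP (psd0 mP)).
move=> c u v /H10P[su wu au] /H10P[sv wv av]; apply/H10P; split.
- exact: (psdZD mP).
- move=> phi tphi i; rewrite dcompZD.
  have [t1 t2] := test_L2sob tphi.
  rewrite (psd_lin P)//; [|exact: su.1|exact: sv.1].
  rewrite (psd_lin P)//; [|exact: su.2|exact: sv.2].
  by rewrite addrACA -mulrDr wu// wv// mulr0 addr0.
- move=> e e0.
  have e10 : 0 < e / (2 * (c ^+ 2 + 1)).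
    by rewrite divr_gt0// mulr_gt0// ltr_wpDl ?sqr_ge0.
  have [phi tphi [mphi sphi]] := au _ e10.
  have [psi tpsi [mpsi spsi]] := av _ e10.
  exists (fun x => c * phi x + psi x); first exact: test_function_lin.
  rewrite jet_lin//.
  have -> : c *: u + v - (c *: jet phi + jet psi) = c *: (u - jet phi) + (v - jet psi).
    by rewrite scalerBr opprD addrACA.
  have su1 : L2sob Omega (u - jet phi) by apply: (psdB mP) => //; apply: test_L2sob.
  have sv1 : L2sob Omega (v - jet psi) by apply: (psdB mP) => //; apply: test_L2sob.
  exact: (conj (form_sqrZD_lt mP su1 sv1 mphi mpsi) (form_sqrZD_lt sP su1 sv1 sphi spsi)).
Qed.

End H10.

(** * Friedrichs inequality and completeness of [H10] *)

Section Friedrichs.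
Context {R : realType} {d : nat}.
Variables (Omega : set 'rV[R]_d) (M : R).
Hypothesis mO : measurable Omega.
Hypothesis OM : Omega `<=` rV_box d M.
Local Notation leb := (lebesgue_rV R d).
Local Notation ip := (ipD leb Omega).
Local Notation nrm := (seminorm (E := 'rV[R]_d -> R^o) ip).
Implicit Types v w : @sobolev R d.

Let P := sqint_psd leb mO.

Let arith1 (x y z x' y' z' : R) : x' + y' + z' = 0 ->
  x + y + z = x - x' + (y - y') + (z - z').
Proof. by move=> h; lra. Qed.

Let arith2 (x y s t : R) : x + y + y = 0 -> - s <= y -> s <= t -> x <= 2 * t.
Proof. by move=> h1 h2 h3; lra. Qed.

Let arith3 (x y x' y' : R) : x' + y' = 0 -> x + y = - (x' - x + (y' - y)).
Proof. by move=> h; lra. Qed.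

Definition coordM (i : 'I_d) (f : 'rV[R]_d -> R^o) : 'rV[R]_d -> R^o :=
  fun x => x 0 i * f x.

Lemma coordM_sqint i f : sqint leb Omega f ->
  sqint leb Omega (coordM i f) /\ nrm (coordM i f) <= `|M| * nrm f.
Proof.
move=> sf; have mh : measurable_fun Omega (fun x : 'rV[R]_d => x 0 i).
  by apply: continuous_measurable_rV => //; apply: coord_continuous.
have hM x : Omega x -> `|x 0 i| <= M by move=> /OM; apply.
have [s h] := bounded_mul_sqint mO mh hM sf; split => //.
rewrite /seminorm -sqrtr_sqr -sqrtrM ?sqr_ge0// ler_sqrt//.
by rewrite mulr_ge0 ?sqr_ge0//; apply: (psd_ge0 P).
Qed.

(* The weak gradient of [v] is tested against [x_i phi] with [phi] close to [v]:
   in the limit, [|v|^2 = - 2 (d_i v, x_i v)]. *)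
Lemma friedrichs (i : 'I_d) v : H10 Omega v ->
  mass Omega v v <= (2 * M) ^+ 2 * stiff Omega v v.
Proof.
move=> Hv; have /(H10P mO OM)[sv wg ap] := Hv.
pose f : 'rV[R]_d -> R^o := v.1; pose g := dcomp v i.
have sf : sqint leb Omega f by exact: sv.1.
have sg : sqint leb Omega g by exact: sv.2.
have [sXf nXf] := coordM_sqint i sf; have [sXg nXg] := coordM_sqint i sg.
have fXg : ip f (coordM i g) = ip g (coordM i f).
  by apply: eq_Rintegral => x _; rewrite /coordM [LHS]mulrCA [RHS]mulrCA [g x * _]mulrC.
have n0 h : 0 <= nrm h by apply: seminorm_ge0.
pose K := nrm f + `|M| * nrm f + `|M| * nrm g.
have K0 : 0 <= K by rewrite !addr_ge0 ?mulr_ge0.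
have key e : 0 < e -> `|ip f f + ip f (coordM i g) + ip g (coordM i f)| <= K * e.
  move=> e0; have [phi tphi [h1 h2]] := ap _ (exprn_gt0 2 e0).
  have [sp sdp] := test_L2sob mO OM tphi.
  pose p : 'rV[R]_d -> R^o := phi; pose dp := dcomp (jet phi) i.
  pose r := f - p; pose s := g - dp.
  have sp' : sqint leb Omega p by exact: sp.
  have sdp' : sqint leb Omega dp by exact: sdp.
  have sr : sqint leb Omega r by apply: (psdB P).
  have ss : sqint leb Omega s by apply: (psdB P).
  have nr : nrm r <= e.
    rewrite -(ger0_norm (ltW e0)) -sqrtr_sqr ler_sqrt ?sqr_ge0//; exact: ltW.
  have ns : nrm s <= e.
    rewrite -(ger0_norm (ltW e0)) -sqrtr_sqr ler_sqrt ?sqr_ge0//.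
    apply: le_trans (ltW h2); rewrite /stiff (bigD1 i)//= dcompB.
    rewrite lerDl; apply: sumr_ge0 => j _; apply: (psd_ge0 P).
    rewrite dcompB; apply: (psdB P) => //; exact: sv.2.
  have [sXp _] := coordM_sqint i sp'; have [sXdp _] := coordM_sqint i sdp'.
  have [sXr nXr] := coordM_sqint i sr; have [sXs nXs] := coordM_sqint i ss.
  (* The [i]-th derivative of [x_i phi] is [phi + x_i d_i phi]; its first term is the source of
     [ip f f]. *)
  have := wg _ (test_function_coordM i tphi) i.
  have -> : dcomp (jet (fun x : 'rV[R]_d => x 0 i * phi x)) i = p + coordM i dp.
    apply/funext => x; rewrite /dcomp/= grad_coordM ?eqxx ?mul1r//.
    exact: test_derivable tphi.
  rewrite -/f -/g -[X in ip g X]/(coordM i p) (formDr P)// => w0.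
  have XB h k : coordM i (h - k) = coordM i h - coordM i k.
    by apply/funext => x; rewrite /coordM /= mulrBr.
  (* With [p] and [dp] for [f] and [g] in the second slots the expression vanishes by [w0];
     subtracting it leaves residuals only. *)
  have -> : ip f f + ip f (coordM i g) + ip g (coordM i f) =
      ip f r + ip f (coordM i s) + ip g (coordM i r).
    rewrite /r /s !XB !(formBr P)//.
    exact: arith1 w0.
  have b1 : `|ip f r| <= nrm f * e.
    by apply: le_trans (form_CS P sf sr) _; apply: ler_wpM2l.
  have b2 : `|ip f (coordM i s)| <= `|M| * nrm f * e.
    apply: le_trans (form_CS P sf sXs) _; rewrite [`|M| * _]mulrC -mulrA.
    apply: ler_wpM2l => //; apply: le_trans nXs _; exact: ler_wpM2l.
  have b3 : `|ip g (coordM i r)| <= `|M| * nrm g * e.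
    apply: le_trans (form_CS P sg sXr) _; rewrite [`|M| * _]mulrC -mulrA.
    apply: ler_wpM2l => //; apply: le_trans nXr _; exact: ler_wpM2l.
  apply: le_trans (ler_normD _ _) _; rewrite /K !mulrDl lerD//.
  by apply: le_trans (ler_normD _ _) _; rewrite lerD.
have key0 : ip f f + ip f (coordM i g) + ip g (coordM i f) = 0.
  apply/eqP; rewrite -normr_le0; apply/ler_addgt0Pr => e e0; rewrite add0r.
  have K1 : 0 < K + 1 by rewrite ltr_wpDl.
  apply: le_trans (key _ (divr_gt0 e0 K1)) _.
  by rewrite mulrA mulrAC ger_pMl// ler_pdivrMr// mul1r lerDl.
have ff : nrm f ^+ 2 <= 2 * (`|M| * nrm f * nrm g).
  rewrite (seminormE P)//.
  have := form_CS P sg sXf; rewrite ler_norml => /andP[h _].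
  have h2 : nrm g * nrm (coordM i f) <= `|M| * nrm f * nrm g.
    by rewrite mulrC; apply: ler_wpM2r.
  by move: key0; rewrite fXg => key0; exact: arith2 key0 h h2.
have fg : nrm f <= 2 * `|M| * nrm g.
  have : 0 <= nrm f by exact: n0.
  rewrite le_eqVlt => /predU1P[<-|f0].
    by rewrite !mulr_ge0.
  rewrite -(ler_pM2l f0) -expr2; apply: le_trans ff _.
  by rewrite le_eqVlt; apply/orP; left; apply/eqP; ring.
have -> : mass Omega v v = nrm f ^+ 2 by rewrite (seminormE P).
apply: (@le_trans _ _ ((2 * M) ^+ 2 * ip g g)).
  have -> : (2 * M) ^+ 2 * ip g g = (2 * `|M| * nrm g) ^+ 2.
    by rewrite !exprMn real_normK ?num_real// (seminormE P).
  by rewrite lerXn2r ?nnegrE// !mulr_ge0.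
apply: ler_wpM2l; first exact: sqr_ge0.
rewrite /stiff (bigD1 i)//= lerDl; apply: sumr_ge0 => j _; apply: (psd_ge0 P).
exact: sv.2.
Qed.

(** The limit is assembled from the L^2 limits of the function and of each partial derivative. The
    weak gradient identity passes to the limit by Cauchy-Schwarz, and a test function close to some
    [x n] is close to [l]. *)
Lemma H10_complete (x : nat -> @sobolev R d) : (forall n, H10 Omega (x n)) ->
  cauchy_for (mass Omega) x -> cauchy_for (stiff Omega) x ->
  exists2 l, H10 Omega l &
    converges_for (mass Omega) x l /\ converges_for (stiff Omega) x l.
Proof.
move=> Hx cm cs.
have mP := mass_psd mO; have sP := stiff_psd mO.
have sx n := H10_L2sob mO (Hx n).
have [l1 sl1 cl1] := sqint_complete mO (fun n => (sx n).1) cm.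
have ci i : cauchy_for ip (fun n => dcomp (x n) i).
  move=> e e0; have [N HN] := cs e e0; exists N => m n Nm Nn.
  apply: le_lt_trans (HN m n Nm Nn); rewrite /stiff (bigD1 i)//= dcompB lerDl.
  apply: sumr_ge0 => j _; apply: (psd_ge0 P); rewrite dcompB.
  by apply: (psdB P); [exact: (sx m).2|exact: (sx n).2].
have ex i : exists g, sqint leb Omega g /\ converges_for ip (fun n => dcomp (x n) i) g.
  by have [g sg cg] := sqint_complete mO (fun n => (sx n).2 i) (ci i); exists g.
have [g Hg] := choice ex.
pose l : @sobolev R d := (l1, fun y => \row_i g i y).
have dl i : dcomp l i = g i by apply/funext => y; rewrite /dcomp mxE.
have sl : L2sob Omega l by split => // i; rewrite dl; case: (Hg i).
have cvs : converges_for (stiff Omega) x l.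
  move=> e e0.
  (* With [d + 1] rather than [d], the sum of [d] such terms is strictly below [e], also for
     [d = 0]. *)
  have d0 : 0 < e / d.+1%:R by rewrite divr_gt0.
  have /choice[N HN] i : exists N, forall n, (N <= n)%N ->
      ip (dcomp (x n) i - g i) (dcomp (x n) i - g i) < e / d.+1%:R.
    by have [_ /(_ _ d0)] := Hg i.
  exists (\max_i N i)%N => n Nn; rewrite /stiff.
  apply: (@le_lt_trans _ _ (\sum_(i < d) e / d.+1%:R)).
    apply: ler_sum => i _; rewrite dcompB dl; apply/ltW/HN.
    by apply: leq_trans Nn; apply: leq_bigmax.
  rewrite sumr_const card_ord -[ltLHS]mulr_natr -mulrA gtr_pMr// mulrC ltr_pdivrMr//.
  by rewrite mul1r ltr_nat.
exists l; last by split.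
apply/(H10P mO OM); split => //.
- move=> phi tphi i; rewrite dl.
  have [tp tdp] := test_L2sob mO OM tphi.
  set dp := dcomp (jet phi) i; have sdp : sqint leb Omega dp by exact: tdp.
  pose p : 'rV[R]_d -> R^o := phi; have sp : sqint leb Omega p by exact: tp.
  have [sgi cgi] := Hg i.
  have n0 h : 0 <= nrm h by apply: seminorm_ge0.
  have K1 : 0 < nrm dp + nrm p + 1 by rewrite ltr_wpDl// addr_ge0.
  apply/eqP; rewrite -normr_le0; apply/ler_addgt0Pr => e e0; rewrite add0r.
  have q0 : 0 < e / (nrm dp + nrm p + 1) by rewrite divr_gt0.
  set q := e / _ in q0.
  have [N1 H1] := cl1 _ (exprn_gt0 2 q0); have [N2 H2] := cgi _ (exprn_gt0 2 q0).
  pose n := maxn N1 N2.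
  have {}H1 := H1 n (leq_maxl _ _); have {}H2 := H2 n (leq_maxr _ _).
  have s1 : sqint leb Omega (x n).1 by exact: (sx n).1.
  have s2 : sqint leb Omega (dcomp (x n) i) by exact: (sx n).2.
  have sr1 : sqint leb Omega ((x n).1 - l1) by apply: (psdB P).
  have sr2 : sqint leb Omega (dcomp (x n) i - g i) by apply: (psdB P).
  have le_q h : ip h h < q ^+ 2 -> nrm h <= q.
    by move=> hq; rewrite -(ger0_norm (ltW q0)) -sqrtr_sqr ler_sqrt ?sqr_ge0//; exact: ltW.
  have /(H10P mO OM)[_ /(_ _ tphi i) w0 _] := Hx n.
  have -> : ip l1 dp + ip (g i) p =
     - (ip ((x n).1 - l1) dp + ip (dcomp (x n) i - g i) p).
    rewrite !(formBl P)//.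
    exact: arith3 w0.
  rewrite normrN; apply: le_trans (ler_normD _ _) _.
  apply: (@le_trans _ _ (q * nrm dp + q * nrm p)).
    apply: lerD.
      apply: le_trans (form_CS P sr1 sdp) _; apply: ler_wpM2r => //; exact: le_q.
    apply: le_trans (form_CS P sr2 sp) _; apply: ler_wpM2r => //; exact: le_q.
  have -> : e = q * (nrm dp + nrm p + 1) by rewrite /q divfK// gt_eqF.
  by rewrite !mulrDr mulr1 lerDl ltW.
- move=> e e0.
  (* The tolerance of [form_sqrZD_lt] at [c = -1], for [l - jet phi = - (x n - l) + (x n - jet
     phi)]. *)
  have e20 : 0 < e / (2 * ((-1) ^+ 2 + 1)) by rewrite divr_gt0// mulr_gt0// sqrrN expr1n.
  have [N1 H1] := cl1 _ e20; have [N2 H2] := cvs _ e20.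
  pose n := maxn N1 N2.
  have {}H1 := H1 n (leq_maxl _ _); have {}H2 := H2 n (leq_maxr _ _).
  have /(H10P mO OM)[_ _ /(_ _ e20)[phi tphi [h1 h2]]] := Hx n.
  exists phi => //.
  have -> : l - jet phi = -1 *: (x n - l) + (x n - jet phi).
    by rewrite scaleN1r opprB addrA subrK.
  have sn1 : L2sob Omega (x n - l) by apply: (psdB mP).
  have sn2 : L2sob Omega (x n - jet phi).
    by apply: (psdB mP) => //; apply: (test_L2sob mO OM).
  exact: (conj (form_sqrZD_lt mP sn1 sn2 H1 h1) (form_sqrZD_lt sP sn1 sn2 H2 h2)).
Qed.

End Friedrichs.

(** * Simplices and triangulations *)

Section EuclideanNorm.
Context {R : realType} {d : nat}.
Implicit Types x y : 'rV[R]_d.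

Lemma dot_psd : psd_form (fun _ : 'rV[R]_d => True) (@dot R d).
Proof.
split => //.
- by move=> u v _ _; apply: eq_bigr => i _; rewrite mulrC.
- move=> c u v w _ _ _; rewrite /dot mulr_sumr -big_split/=.
  by apply: eq_bigr => i _; rewrite !mxE mulrDl mulrA.
- by move=> u _; apply: sumr_ge0 => i _; rewrite -expr2 sqr_ge0.
Qed.

Lemma enorm_ge0 x : 0 <= enorm x. Proof. exact: sqrtr_ge0. Qed.

Lemma enormD x y : enorm (x + y) <= enorm x + enorm y.
Proof. exact: (seminormD dot_psd (u := x) (v := y)). Qed.

Lemma enormN x : enorm (- x) = enorm x.
Proof. exact: (seminormN dot_psd (u := x)). Qed.

Lemma enormZ c x : enorm (c *: x) = `|c| * enorm x.
Proof. exact: (seminormZ dot_psd c (u := x)). Qed.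

Lemma enormB x y : enorm (x - y) = enorm (y - x).
Proof. by rewrite -enormN opprB. Qed.

Lemma enorm_trans x y z : enorm (x - z) <= enorm (x - y) + enorm (y - z).
Proof. by apply: le_trans (enormD _ _); rewrite addrA subrK. Qed.

Lemma enorm_sqr x : enorm x ^+ 2 = dot x x.
Proof. exact: (seminormE dot_psd (v := x)). Qed.

Lemma enorm_coord x i : `|x 0 i| <= enorm x.
Proof.
rewrite -(@ler_pXn2r _ 2)// ?nnegrE ?enorm_ge0// enorm_sqr real_normK ?num_real//.
rewrite /dot (bigD1 i)//= -expr2 lerDl; apply: sumr_ge0 => j _.
by rewrite -expr2 sqr_ge0.
Qed.

Lemma enorm_le_sum x : enorm x <= \sum_i `|x 0 i|.
Proof.
have {1}-> : x = \sum_i x 0 i *: delta_mx 0 i by exact: row_sum_delta.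
elim/big_ind2 : _ => [|a u b v au bv|i _].
- by rewrite /enorm (form0l dot_psd)// sqrtr0.
- exact: le_trans (enormD _ _) (lerD au bv).
- rewrite enormZ (_ : enorm _ = 1) ?mulr1//.
  rewrite /enorm /dot (bigD1 i)//= big1 ?addr0 => [|j ji]; rewrite !mxE eqxx/=.
    by rewrite eqxx mulr1 sqrtr1.
  by rewrite (negbTE ji) mulr0.
Qed.

Lemma nbhs_enormP x (U : set 'rV[R]_d) :
  nbhs x U <-> exists2 e : R, 0 < e & forall y, enorm (y - x) < e -> U y.
Proof.
split=> [/rV_nbhsP[e e0 eU]|[e e0 eU]].
  exists e => // y yx; apply: eU => i; apply: le_lt_trans yx.
  by rewrite distrC; have := enorm_coord (y - x) i; rewrite !mxE.
apply/rV_nbhsP; exists (e / d.+1%:R); first by rewrite divr_gt0.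
move=> y xy; apply: eU; apply: le_lt_trans (enorm_le_sum _) _.
apply: (@le_lt_trans _ _ (\sum_(i < d) e / d.+1%:R)).
  by apply: ler_sum => i _; rewrite !mxE distrC; apply/ltW/xy.
rewrite sumr_const card_ord -[ltLHS]mulr_natr -mulrA gtr_pMr// mulrC ltr_pdivrMr//.
by rewrite mul1r ltr_nat.
Qed.

End EuclideanNorm.

Section Simplices.
Context {R : realType} {d : nat}.
Implicit Types (P : 'M[R]_(d.+1, d)) (I : {set 'I_d.+1}).

Lemma sum_delta_mx n (k : 'I_n) : \sum_i (delta_mx 0 k : 'rV[R]_n) 0 i = 1.
Proof.
rewrite (bigD1 k)//= mxE !eqxx big1 ?addr0// => i ik.
by rewrite mxE (negbTE ik) andbF.
Qed.

Lemma vertex_simplex P k : simplex P (row k P).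
Proof.
exists (delta_mx 0 k); split.
- by move=> i; rewrite mxE; case: (_ && _).
- by move=> i; rewrite inE.
- exact: sum_delta_mx.
- by rewrite -rowE.
Qed.

Lemma simplex_bounded P : exists M, simplex P `<=` rV_box d M.
Proof.
exists (\sum_i \sum_j `|P i j|) => x [w [w0 _ w1 ->]] j; rewrite mxE.
apply: le_trans (ler_norm_sum _ _ _) _; apply: ler_sum => i _.
rewrite normrM ger0_norm//.
have wi1 : w 0 i <= 1.
  by rewrite -w1 (bigD1 i)//= lerDl; apply: sumr_ge0.
apply: (@le_trans _ _ `|P i j|); first exact: ler_piMl.
by rewrite (bigD1 j)//= lerDl; apply: sumr_ge0.
Qed.

Lemma le_diam_simplex P x y : simplex P x -> simplex P y ->
  enorm (x - y) <= diam (simplex P).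
Proof.
move=> Px Py; have [M HM] := simplex_bounded P.
apply: ub_le_sup; last by exists (x, y).
exists (\sum_(i < d) (M + M)) => _ [[a b] [/= Pa Pb] <-] /=.
apply: le_trans (enorm_le_sum _) _; apply: ler_sum => i _; rewrite !mxE.
by apply: le_trans (ler_normB _ _) _; rewrite lerD//; [apply: (HM a)|apply: (HM b)].
Qed.

(** The rows [(1, vertex)] are independent, and the two conditions together say that [z] annihilates
    them. *)
Lemma affine_combination0 P (z : 'rV[R]_d.+1) : affinely_independent P ->
  \sum_i z 0 i = 0 -> z *m P = 0 -> z = 0.
Proof.
move=> aP z1 zP; apply/eqP; rewrite -(mulmx_free_eq0 _ aP) mul_mx_row zP.
have -> : z *m (const_mx 1 : 'cV[R]_d.+1) = 0.
  apply/matrixP => i j; rewrite !mxE ord1 -[RHS]z1.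
  by apply: eq_bigr => k _; rewrite mxE mulr1.
by rewrite row_mx0.
Qed.

Lemma diam_simplex_gt0 P : (0 < d)%N -> affinely_independent P -> 0 < diam (simplex P).
Proof.
move=> d0 aP; pose k : 'I_d.+1 := ord0; pose l : 'I_d.+1 := ord_max.
have kl : k != l by rewrite -val_eqE/= eq_sym -lt0n.
apply: lt_le_trans (le_diam_simplex (vertex_simplex P k) (vertex_simplex P l)).
rewrite lt_def enorm_ge0 andbT; apply/eqP => e0.
pose z : 'rV[R]_d.+1 := delta_mx 0 k - delta_mx 0 l.
have /(affine_combination0 aP) : \sum_i z 0 i = 0.
  have -> : \sum_i z 0 i = \sum_i ((delta_mx 0 k : 'rV[R]_d.+1) 0 i -
      (delta_mx 0 l : 'rV[R]_d.+1) 0 i).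
    by apply: eq_bigr => i _; rewrite !mxE.
  by rewrite sumrB !sum_delta_mx subrr.
have -> : z *m P = 0.
  rewrite mulmxBl -!rowE; apply/rowP => i; rewrite mxE [RHS]mxE; apply/eqP.
  rewrite -normr_le0 -e0.
  by have := enorm_coord (row k P - row l P) i; rewrite !mxE.
move=> /(_ erefl)/rowP/(_ k); rewrite !mxE !eqxx (negbTE kl)/= subr0 => /eqP.
by rewrite oner_eq0.
Qed.

(** From a point of the face, a small step towards a vertex [k] outside [I] stays in the ball but
    acquires weight [t > 0] at [k], against the uniqueness of barycentric coordinates. *)
Lemma face_no_ball P I (x : 'rV[R]_d) (e : R) : affinely_independent P ->
  I != [set: 'I_d.+1]%SET -> 0 < e ->
  ~ (forall y, enorm (y - x) < e -> face P I y).
Proof.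
move=> aP IT e0 H.
have [k kI] : exists k, k \notin I.
  apply/existsP; rewrite -negb_forall; apply: contra IT => /forallP h.
  by apply/eqP/setP => k; rewrite inE h.
have [w [_ wI w1 xE]] : face P I x.
  by apply: H; rewrite subrr /enorm (form0l dot_psd)// sqrtr0.
pose t := e / (enorm (row k P - x) + 1).
have n1 : 0 < enorm (row k P - x) + 1 by rewrite ltr_wpDl// enorm_ge0.
have t0 : 0 < t by rewrite divr_gt0.
have [w' [_ w'I w'1 yE]] : face P I (x + t *: (row k P - x)).
  apply: H; rewrite addrAC subrr add0r enormZ gtr0_norm// /t mulrAC.
  by rewrite ltr_pdivrMr// ltr_pM2l// ltrDl.
pose z := w' - (1 - t) *: w - t *: delta_mx 0 k.
have z1 : \sum_i z 0 i = 0.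
  have -> : \sum_i z 0 i = \sum_i (w' 0 i - (1 - t) * w 0 i - t * (delta_mx 0 k : 'rV[R]_d.+1) 0 i).
    by apply: eq_bigr => i _; rewrite !mxE.
  by rewrite !sumrB -!mulr_sumr w'1 w1 sum_delta_mx; ring.
have zP : z *m P = 0.
  rewrite !mulmxBl -!scalemxAl -yE -xE -rowE; apply/rowP => i; rewrite !mxE; ring.
have /rowP/(_ k) := affine_combination0 aP z1 zP.
rewrite !mxE wI// w'I// !eqxx/= => /eqP.
by rewrite mulr0 subr0 add0r mulr1 oppr_eq0 gt_eqF.
Qed.

(** A finite intersection of half-spaces: [lam k] is the [k]-th barycentric coordinate, affine in
    [x], read off from the inverse of the matrix with rows [(1, vertex)]. *)
Lemma simplex_measurable P : affinely_independent P -> measurable (simplex P).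
Proof.
move=> aP; pose Q : 'M[R]_(1 + d) := row_mx (const_mx 1 : 'cV[R]_d.+1) P.
have uQ : Q \in unitmx by rewrite -row_free_unit.
pose lam (k : 'I_d.+1) (x : 'rV[R]_d) : R := (row_mx (const_mx 1 : 'cV[R]_1) x *m invmx Q) 0 k.
have lamE k x : lam k x = \sum_(j < d) x 0 j * invmx Q (rshift 1 j) k + invmx Q (lshift d 0) k.
  rewrite /lam mxE big_split_ord/= big_ord1 addrC; congr (_ + _).
    by apply: eq_bigr => j _; rewrite row_mxEr.
  by rewrite row_mxEl mxE mul1r.
have -> : simplex P = \bigcap_(k in [set: 'I_d.+1]) [set x | 0 <= lam k x].
  apply/seteqP; split => x.
    move=> [w [w0 _ w1 ->]] k _ /=; rewrite /lam.
    have -> : row_mx (const_mx 1) (w *m P) = w *m Q.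
      rewrite mul_mx_row; congr row_mx; apply/matrixP => i j; rewrite !mxE ord1 -[LHS]w1.
      by apply: eq_bigr => l _; rewrite mxE mulr1.
    by rewrite mulmxK.
  move=> h; pose w := row_mx (const_mx 1 : 'cV[R]_1) x *m invmx Q.
  have : w *m Q = row_mx (const_mx 1) x by rewrite mulmxKV.
  rewrite mul_mx_row => /eq_row_mx[e1 e2]; exists w; split => //.
  - by move=> i; apply: (h i).
  - by move=> i; rewrite inE.
  - have /matrixP/(_ 0 0) := e1; rewrite mxE [RHS]mxE => <-.
    by apply: eq_bigr => l _; rewrite [X in _ * X]mxE mulr1.
apply: fin_bigcap_measurable => // k _.
have mlam : measurable_fun setT (lam k).
  rewrite (_ : lam k = fun x => \sum_(j < d) x 0 j * invmx Q (rshift 1 j) k + invmx Q (lshift d 0) k).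
    apply: measurable_funD => //; apply: measurable_sum => j.
    apply: measurable_funM => //; apply: continuous_measurable_rV => //.
    exact: coord_continuous.
  by apply/funext => x; exact: lamE.
rewrite -[X in measurable X]setTI.
have -> : [set x | 0 <= lam k x] = lam k @^-1` `[0, +oo[.
  by apply/seteqP; split => x /=; rewrite in_itv/= andbT.
exact: mlam.
Qed.

End Simplices.

(** * Lipschitz domains *)

Section Domain.
Context {R : realType} {d : nat}.
Variable Omega : set 'rV[R]_d.

Lemma lipschitz_polytope_bounded : lipschitz_polytope Omega ->
  exists M, Omega `<=` rV_box d M.
Proof.
move=> [_ _ [N [S [_ cE]]]].
have /choice[B HB] i : exists M, simplex (S i) `<=` rV_box d M by exact: simplex_bounded.
exists (\sum_i `|B i|) => x /subset_closure; rewrite cE => -[i _ Six] j.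
apply: le_trans (HB i x Six j) _; apply: le_trans (ler_norm _) _.
by rewrite (bigD1 i)//= lerDl; apply: sumr_ge0.
Qed.

Let arith (p n gz gy ez ey t ex : R) : gz < ez -> gy - gz <= p -> ez - ey <= n ->
  ey = ex - t -> ex <= gy -> p + n + n < t -> 0 <= n -> False.
Proof. by move=> *; lra. Qed.

(* Moving from a boundary point downwards along [e] one leaves the closure. *)
Lemma interior_closure_lipschitz : open Omega -> lipschitz_boundary Omega ->
  interior (closure Omega) `<=` Omega.
Proof.
move=> oO lO x; rewrite /interior/= => /nbhs_enormP[r1 r10 Hr1].
apply: contrapT => nOx.
have cx : closure Omega x.
  by apply: Hr1; rewrite subrr /enorm (form0l dot_psd)// sqrtr0.
have [|r [e [gamma [L [r0 e1 Lip inv HO]]]]] := lO x.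
  by split => //; rewrite (proj1 (interior_id Omega)).
have gx : dot x e <= gamma x.
  rewrite leNgt; apply/negP => h; apply: nOx; apply/HO => //.
  by rewrite subrr /enorm (form0l dot_psd)// sqrtr0.
(* Keeps [y] both in the chart at [x], of radius [r], and in the ball of radius [r1] that lies in
   the closure of [Omega]. *)
pose t := Num.min r r1 / 2.
have t0 : 0 < t by rewrite divr_gt0// lt_min r0 r10.
have tr : t < r by rewrite /t ltr_pdivrMr// (@le_lt_trans _ _ r) ?ge_min ?lexx// mulr_natr mulr2n ltrDl.
have tr1 : t < r1 by rewrite /t ltr_pdivrMr// (@le_lt_trans _ _ r1) ?ge_min ?lexx ?orbT// mulr_natr mulr2n ltrDl.
pose y := x + (- t) *: e.
have yx : enorm (y - x) = t.
  by rewrite /y addrAC subrr add0r enormZ e1 mulr1 normrN gtr0_norm.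
have : closure Omega y by apply: Hr1; rewrite yx.
have ye : dot y e = dot x e - t.
  have -> : y = (- t) *: e + x by rewrite /y addrC.
  rewrite (psd_lin dot_psd)//.
  by rewrite -enorm_sqr e1 expr1n mulr1 addrC.
have gy : gamma y = gamma x by apply: inv.
have Lp : 0 < `|L| + 1 by rewrite ltr_wpDl.
(* The first entry keeps [z] in the chart. By the second, the change of [gamma], at most
   [|L| |z - y|], and that of the height along [e], at most [|z - y|], stay together below the drop
   [t], so [z] cannot lie above the graph. *)
pose del := Num.min (r - t) (t / (`|L| + 1 + 1)).
have del0 : 0 < del by rewrite lt_min subr_gt0 tr divr_gt0// addr_gt0.
have nby : nbhs y [set z | enorm (z - y) < del] by apply/nbhs_enormP; exists del.
move=> /(_ _ nby)[z [Oz /= zy]].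
have zr : enorm (z - x) < r.
  apply: le_lt_trans (enorm_trans _ y _) _; rewrite yx -ltrBrDr.
  by apply: lt_le_trans zy _; rewrite ge_min lexx.
have gz : gamma z < dot z e by apply/(HO z zr).1.
have g1 : gamma y - gamma z <= `|L| * enorm (z - y).
  apply: le_trans (ler_norm _) _; apply: le_trans (Lip _ _) _.
  by rewrite enormB; apply: ler_wpM2r; [exact: enorm_ge0|exact: ler_norm].
have d1 : dot z e - dot y e <= enorm (z - y).
  rewrite -(formBl dot_psd)//; apply: le_trans (ler_norm _) _.
  apply: le_trans (form_CS dot_psd (u := z - y) (v := e) _ _) _ => //.
  by rewrite -[seminorm dot e]/(enorm e) e1 mulr1.
have : (`|L| + 1 + 1) * enorm (z - y) < t.
  rewrite mulrC -ltr_pdivlMr; last exact: addr_gt0.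
  by apply: lt_le_trans zy _; rewrite ge_min lexx orbT.
have := enorm_ge0 (z - y).
rewrite !mulrDl !mul1r => ez h.
by rewrite gy in g1; exact: (arith gz g1 d1 ye gx h ez).
Qed.

End Domain.

(** * Finite overlap of the patches *)

Section Mesh.
Context {R : realType} {d : nat}.
Variables (Omega : set 'rV[R]_d) (N : nat) (T : 'I_N -> 'M[R]_(d.+1, d)).
Variables (sigma kappa : R).
Hypothesis d0 : (0 < d)%N.
Hypothesis triT : triangulation Omega T.
Hypothesis srT : shape_regular T sigma.
Hypothesis quT : quasi_uniform T kappa.

Local Notation h := (meshsize T).

Lemma le_meshsize i : diam (simplex (T i)) <= h.
Proof. exact: (le_bigmax _ (fun i => diam (simplex (T i)))). Qed.

Lemma meshsize_gt0 (i : 'I_N) : 0 < h.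
Proof.
exact: lt_le_trans (diam_simplex_gt0 d0 (tri_nondegenerate triT i)) (le_meshsize i).
Qed.

(** Half of the lower bound [h / (kappa * sigma)] on every inradius: [inradius] is a supremum, so a
    ball is at hand only for smaller radii. *)
Let rho := h / (2 * (kappa * sigma)).

Let consts_gt0 (i : 'I_N) : 0 < kappa * sigma /\ h <= kappa * sigma * inradius (simplex (T i)).
Proof.
have di := diam_simplex_gt0 d0 (tri_nondegenerate triT i).
have h0 := meshsize_gt0 i; have s := srT i; have q := quT i.
have k0 : 0 < kappa by have := lt_le_trans h0 q; rewrite pmulr_lgt0.
have r0 : 0 <= inradius (simplex (T i)).
  have [hs|hs] := pselect (has_sup [set r : R | 0 <= r /\ exists c,
      [set y | enorm (y - c) <= r] `<=` simplex (T i)]).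
    have [r Sr] := hs.1; apply: le_trans Sr.1 _.
    by apply: ub_le_sup => //; exact: hs.2.
  by rewrite /inradius sup_out.
have s0 : 0 < sigma.
  have := lt_le_trans di s; move: r0; rewrite le_eqVlt => /predU1P[<-|r0].
    by rewrite mulr0 ltxx.
  by rewrite pmulr_lgt0.
split; first exact: mulr_gt0.
by apply: le_trans q _; rewrite -mulrA ler_pM2l.
Qed.

Let rho_gt0 (i : 'I_N) : 0 < rho.
Proof.
by have [c _] := consts_gt0 i; apply: divr_gt0; [exact: (meshsize_gt0 i)|exact: mulr_gt0].
Qed.

Let inscribed (i : 'I_N) : exists c, forall y, enorm (y - c) <= rho -> simplex (T i) y.
Proof.
have [c0 hr] := consts_gt0 i.
have [c1 [r [[_ [c Hc]] rr]]] : exists c1 : R, exists r, (0 <= r /\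
    exists c, [set y | enorm (y - c) <= r] `<=` simplex (T i)) /\ rho <= r.
  (* Otherwise the supremum is at most [rho], and [h <= kappa * sigma * inradius] would give
     [h <= h / 2]. *)
  apply: contrapT => nex.
  have : inradius (simplex (T i)) <= rho.
    apply: ge_sup.
      exists 0; split => //; exists (row ord0 (T i)) => y /= yc.
      have -> : y = row ord0 (T i); last exact: vertex_simplex.
      apply/rowP => k; apply/eqP; rewrite -subr_eq0 -normr_le0; apply: le_trans yc.
      by have := enorm_coord (y - row ord0 (T i)) k; rewrite mxE [X in _ + X]mxE.
    move=> r [r0 hc]; rewrite leNgt; apply/negP => rr; apply: nex; exists 0, r.
    by split; [split|exact: ltW].
  rewrite -(ler_pM2l c0) => h2.
  have := le_trans hr h2; rewrite /rho.
  have -> : kappa * sigma * (h / (2 * (kappa * sigma))) = h / 2.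
    by move: (kappa * sigma) c0 => s s0; field; rewrite gt_eqF.
  by have := meshsize_gt0 i; lra.
by exists c => y yc; apply: Hc; apply: le_trans rr.
Qed.

(** Closer centres would put a ball about [c j] into both simplices, hence into a proper face of
    [T i], against [face_no_ball]. *)
Let separated (c : 'I_N -> 'rV[R]_d) :
  (forall i y, enorm (y - c i) <= rho -> simplex (T i) y) ->
  forall i j, i != j -> rho <= enorm (c i - c j).
Proof.
move=> Hc i j ij; rewrite leNgt; apply/negP => cij.
have [I [J [IT _ Iface _]]] := tri_conforming triT ij.
apply: (face_no_ball (tri_nondegenerate triT i) IT (e := rho - enorm (c i - c j)) (x := c j)).
  by rewrite subr_gt0.
move=> y yc; rewrite -Iface; split; last first.
  apply: Hc; apply/ltW; apply: lt_le_trans yc _.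
  by rewrite gerBl enorm_ge0.
apply: Hc; apply: le_trans (enorm_trans _ (c j) _) _.
by rewrite -lerBrDr (enormB (c j)) ltW.
Qed.

(* The centres of the inscribed balls, of radius at least [rho], lie at mutual
   distance at least [rho], hence in distinct cells of a grid of mesh
   [rho / (d + 1)]; those of the patches containing a given point are within
   [2 h] of it, and this counts the cells in that range. *)
Definition overlap_bound : nat :=
  ((Num.truncn (4 * (kappa * sigma) * d.+1%:R)).+1.*2.+1 ^ d)%N.

Lemma patch_overlap (x : 'rV[R]_d) :
  (#|[set i | `[< element_patch T i x >]]%SET| <= overlap_bound)%N.
Proof.
have [c Hc] := choice inscribed.
have sep := separated Hc.
pose m := (Num.truncn (4 * (kappa * sigma) * d.+1%:R)).+1.
(* Coordinates of the centre relative to [x], in units of the cell width; the shift by [m] makes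
   them nonnegative, with integer parts in [0 .. 2 m]. *)
pose q (i : 'I_N) (k : 'I_d) : R := (c i - x) 0 k * d.+1%:R / rho + m%:R.
have near i : element_patch T i x -> enorm (c i - x) <= 2 * h.
  move=> /interior_subset[j [y [Tjy Tiy]] Tjx].
  apply: le_trans (enorm_trans _ y _) _; rewrite mulr_natl mulr2n lerD//.
    apply: le_trans (le_diam_simplex _ Tiy) (le_meshsize i).
    by apply: Hc; rewrite subrr /enorm (form0l dot_psd)// sqrtr0 ltW// (rho_gt0 i).
  exact: le_trans (le_diam_simplex Tjy Tjx) (le_meshsize j).
have qb i k : element_patch T i x -> 0 <= q i k /\ q i k < m.*2.+1%:R.
  move=> /near ci; have r0 := rho_gt0 i; have h0 := meshsize_gt0 i.
  have [ks _] := consts_gt0 i.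
  have : `|(c i - x) 0 k * d.+1%:R / rho| <= m%:R.
    rewrite !normrM (ger0_norm (ler0n _ _)) normfV (gtr0_norm r0).
    apply: (@le_trans _ _ (2 * h * d.+1%:R / rho)).
      rewrite ler_pM2r ?invr_gt0// ler_pM2r ?ltr0n//.
      exact: le_trans (enorm_coord _ _) ci.
    have -> : 2 * h * d.+1%:R / rho = 4 * (kappa * sigma) * d.+1%:R.
      rewrite /rho; move: (kappa * sigma) ks => s s0; move: h h0 => t t0.
      by field; rewrite !gt_eqF.
    exact/ltW/truncnS_gt.
  rewrite ler_norml /q => /andP[q1 q2]; split; first by rewrite -lerBlDr sub0r.
  rewrite -addnn -addnS natrD; apply: ler_ltD => //.
  by rewrite ltr_nat.
pose F (i : 'I_N) : {ffun 'I_d -> 'I_m.*2.+1} := [ffun k => inord (Num.truncn (q i k))].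
rewrite /overlap_bound -/m -[X in (_ <= X ^ _)%N]card_ord -[X in (_ <= _ ^ X)%N]card_ord -card_ffun.
rewrite -(card_in_imset (f := F)); first exact: max_card.
move=> i j; rewrite !inE => xi xj /ffunP Fij.
have {}xi : element_patch T i x by apply/asboolP; apply/asboolP.
have {}xj : element_patch T j x by apply/asboolP; apply/asboolP.
apply/eqP; apply: contrapT => /negP ij.
have := sep i j ij; rewrite leNgt => /negP; apply.
have r0 := rho_gt0 i.
apply: le_lt_trans (enorm_le_sum _) _.
(* In a common cell each coordinate of [c i - c j] is at most [rho / (d + 1)], and [d] of these add
   up to less than [rho]. *)
apply: (@le_lt_trans _ _ (\sum_(k < d) rho / d.+1%:R)).
  apply: ler_sum => k _.
  have := Fij k; rewrite !ffunE => /(congr1 val) /=.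
  have [qi0 qi1] := qb i k xi; have [qj0 qj1] := qb j k xj.
  have trlt (a : R) : 0 <= a -> a < m.*2.+1%:R -> (Num.truncn a < m.*2.+1)%N.
    by move=> a0 am; rewrite -(ltr_nat R); apply: le_lt_trans am; have /andP[] := truncn_itv a0.
  rewrite !inordK ?trlt// => tij.
  have ti := truncn_itv qi0; have tj := truncn_itv qj0.
  move: ti tj; rewrite tij => /andP[t1 t2] /andP[t3 t4].
  have dq : `|q i k - q j k| <= 1.
    by rewrite ler_norml; move: t2 t4; rewrite -natr1 => t2 t4; apply/andP; split; lra.
  have qd : q i k - q j k = (c i - c j) 0 k * (d.+1%:R / rho).
    by rewrite /q !mxE; ring.
  have D0 : 0 < d.+1%:R / rho by exact: divr_gt0.
  by move: dq; rewrite qd normrM (gtr0_norm D0) -ler_pdivlMr// mul1r invf_div.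
rewrite sumr_const card_ord -[ltLHS]mulr_natr -mulrA gtr_pMr// mulrC ltr_pdivrMr//.
by rewrite mul1r ltr_nat.
Qed.

Lemma element_patch_sub i : open Omega -> lipschitz_boundary Omega ->
  element_patch T i `<=` Omega.
Proof.
move=> oO lO; apply: subset_trans (interior_closure_lipschitz oO lO).
apply: interiorS; rewrite -(tri_cover triT) => x [j _ Tjx]; by exists j.
Qed.

Lemma element_patch_measurable i : measurable (element_patch T i).
Proof. by apply: open_measurable_rV; apply: open_interior. Qed.

End Mesh.

(** * The discrete problem *)

Section LocalSums.
Context {R : realType} {d : nat}.
Local Notation leb := (lebesgue_rV R d).
Variables (Omega : set 'rV[R]_d) (N : nat) (D : 'I_N -> set 'rV[R]_d).
Hypothesis mO : measurable Omega.
Hypothesis mD : forall i, measurable (D i).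

(** Pointwise, [f ^ 2] is at most the sum of its restrictions. The pieces are cut with [Omega]
    because a closed simplex may leave it, and nothing is known of [f] outside. *)
Lemma ipD_cover f : Omega `<=` \bigcup_i D i -> sqint leb Omega f ->
  ipD leb Omega f f <= \sum_i ipD leb (Omega `&` D i) f f.
Proof.
move=> cov sf.
have mOD i : measurable (Omega `&` D i) by apply: measurableI.
have sOD i : sqint leb (Omega `&` D i) f.
  move: sf => /sqintP[mf f2]; apply/sqintP; split.
    by apply: measurable_funS mf => //; apply: subIsetl.
  by apply: integrableS f2 => //; apply: subIsetl.
rewrite -lee_fin -sumEFin ipDE//.
under eq_bigr do rewrite ipDE// integral_mkcondr.
have mf : measurable_fun Omega (fun x => (f x ^+ 2)%:E : \bar R).
  by apply/measurable_EFinP; apply: measurable_funX; case: sf.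
rewrite -ge0_integral_sum//; last 2 first.
- by move=> i; apply/(measurable_restrict _ (mD i) mO); apply: measurable_funS mf => //; apply: subIsetl.
- by move=> i x _; rewrite /patch; case: ifP; rewrite ?lee_fin ?sqr_ge0.
apply: le_integral_ge0 => x Ox; first by rewrite lee_fin sqr_ge0.
have [i _ Dix] := cov x Ox.
rewrite (bigD1 i)//= {1}/patch mem_set// leeDl//.
by apply: sume_ge0 => j _; rewrite /patch; case: ifP; rewrite ?lee_fin ?sqr_ge0.
Qed.

(** The indicators of the [D i] add up, at each point, to the number of sets containing it. *)
Lemma ipD_overlap f (K : nat) : (forall i, D i `<=` Omega) ->
  (forall x, (#|[set i | `[< D i x >]]%SET| <= K)%N) -> sqint leb Omega f ->
  \sum_i ipD leb (D i) f f <= K%:R * ipD leb Omega f f.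
Proof.
move=> DO ov sf.
have sD i : sqint leb (D i) f.
  move: sf => /sqintP[mf f2]; apply/sqintP; split.
    exact: measurable_funS mf.
  exact: integrableS f2.
have /sqintP[_ f2] := sf.
have mf : measurable_fun Omega (fun x => (f x ^+ 2)%:E : \bar R).
  by apply/measurable_EFinP; apply: measurable_funX; case: sf.
rewrite -lee_fin -sumEFin EFinM ipDE//.
have e i : (ipD leb (D i) f f)%:E = (\int[leb]_(x in Omega) ((fun x => (f x ^+ 2)%:E) \_ (D i)) x)%E.
  rewrite ipDE// -integral_mkcondr; congr (integral _ _ _).
  by apply/esym/setIidr.
under eq_bigr do rewrite e.
rewrite -ge0_integral_sum//; last 2 first.
- by move=> i; apply/(measurable_restrict _ (mD i) mO); apply: measurable_funS mf => //; apply: subIsetl.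
- by move=> i x _; rewrite /patch; case: ifP; rewrite ?lee_fin ?sqr_ge0.
rewrite -(integralZl mO f2).
apply: le_integral_ge0 => x Ox.
  by apply: sume_ge0 => j _; rewrite /patch; case: ifP; rewrite ?lee_fin ?sqr_ge0.
rewrite /patch (eq_bigr (fun i => if `[< D i x >] then (f x ^+ 2)%:E else 0%E)).
  rewrite -big_mkcond/= sumEFin -EFinM lee_fin sumr_const -[leLHS]mulr_natl.
  apply: ler_wpM2r; first exact: sqr_ge0.
  rewrite ler_nat; apply: leq_trans (ov x).
  by rewrite cardsE.
move=> i _; case: asboolP => Dx; first by rewrite mem_set.
by rewrite memNset.
Qed.

End LocalSums.

Section SobolevLocalSums.
Context {R : realType} {d : nat}.
Variables (Omega : set 'rV[R]_d) (N : nat) (D : 'I_N -> set 'rV[R]_d).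
Hypothesis mO : measurable Omega.
Hypothesis mD : forall i, measurable (D i).
Implicit Types v : @sobolev R d.

Lemma mass_cover v : Omega `<=` \bigcup_i D i -> L2sob Omega v ->
  mass Omega v v <= \sum_i mass (Omega `&` D i) v v.
Proof. by move=> cov [sv _]; apply: ipD_cover. Qed.

Lemma stiff_cover v : Omega `<=` \bigcup_i D i -> L2sob Omega v ->
  stiff Omega v v <= \sum_i stiff (Omega `&` D i) v v.
Proof.
move=> cov [_ sv]; rewrite /stiff exchange_big/=; apply: ler_sum => k _.
by apply: ipD_cover => //; apply: sv.
Qed.

Lemma mass_overlap v (K : nat) : (forall i, D i `<=` Omega) ->
  (forall x, (#|[set i | `[< D i x >]]%SET| <= K)%N) -> L2sob Omega v ->
  \sum_i mass (D i) v v <= K%:R * mass Omega v v.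
Proof. by move=> DO ov [sv _]; apply: ipD_overlap. Qed.

Lemma stiff_overlap v (K : nat) : (forall i, D i `<=` Omega) ->
  (forall x, (#|[set i | `[< D i x >]]%SET| <= K)%N) -> L2sob Omega v ->
  \sum_i stiff (D i) v v <= K%:R * stiff Omega v v.
Proof.
move=> DO ov [_ sv]; rewrite /stiff exchange_big/= mulr_sumr; apply: ler_sum => k _.
by apply: ipD_overlap => //; apply: sv.
Qed.

End SobolevLocalSums.

Section AeIntegrals.
Context dd {X : measurableType dd} {R : realType}.
Variables (mu : {measure set X -> \bar R}) (D : set X).
Hypothesis mD : measurable D.

Lemma ae_bounded_integrableM (h g : X -> R) (B : R) : measurable_fun D h ->
  {ae mu, forall x, D x -> `|h x| <= B} ->
  mu.-integrable D (EFin \o g) -> mu.-integrable D (fun x => (h x * g x)%:E).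
Proof.
move=> mh hB gi; have /integrableP[mg glt] := gi.
have mg' : measurable_fun D g by apply/measurable_EFinP.
apply/integrableP; split; first by apply/measurable_EFinP; apply: measurable_funM.
apply: (@le_lt_trans _ _ (\int[mu]_(x in D) (`|B|%:E * `|(g x)%:E|))%E).
  apply: ae_ge0_le_integral => //.
  - by apply: measurableT_comp => //; apply/measurable_EFinP; apply: measurable_funM.
  - by apply: measurable_funeM; apply: measurableT_comp => //.
  - apply: filterS hB => x hx Dx; rewrite -EFinM lee_fin normrM.
    by apply: ler_wpM2r => //; apply: le_trans (hx Dx) (ler_norm _).
rewrite ge0_integralZl//; last by apply: measurableT_comp => //.
by apply: lte_mul_pinfty.
Qed.

(** The integrand [g - f] is replaced by [|g - f|], which equals it almost everywhere and is
    nonnegative everywhere. *)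
Lemma ae_le_Rintegral (f g : X -> R) :
  mu.-integrable D (EFin \o f) -> mu.-integrable D (EFin \o g) ->
  {ae mu, forall x, D x -> f x <= g x} ->
  \int[mu]_(x in D) f x <= \int[mu]_(x in D) g x.
Proof.
move=> fi gi fg; rewrite -subr_ge0 -RintegralB//.
have mf : measurable_fun D f by apply/measurable_EFinP; apply: measurable_int fi.
have mg : measurable_fun D g by apply/measurable_EFinP; apply: measurable_int gi.
rewrite (_ : \int[mu]_(x in D) (g x - f x) = \int[mu]_(x in D) `|g x - f x|).
  exact: Rintegral_ge0.
congr fine; apply: ae_eq_integral => //.
- by apply/measurable_EFinP; apply: measurable_funB.
- by apply/measurable_EFinP; apply: measurableT_comp => //; apply: measurable_funB.
- by apply: filterS fg => x hx Dx; rewrite ger0_norm// subr_ge0 hx.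
Qed.

End AeIntegrals.

(** * The energy form of the coefficient *)

Section EnergyForm.
Context {R : realType} {d : nat}.
Local Notation leb := (lebesgue_rV R d).
Variables (Omega : set 'rV[R]_d) (alpha beta : R) (A : 'rV[R]_d -> 'M[R]_d).
Hypothesis mO : measurable Omega.
Hypothesis alpha0 : 0 < alpha.
Hypothesis cA : coefficient Omega alpha beta A.
Implicit Types v w : @sobolev R d.
Local Notation a := (aform Omega A).

Let integrandE v w x : dot (w.2 x) (v.2 x *m (A x)^T) =
  \sum_i \sum_j A x i j * (w.2 x 0 i * v.2 x 0 j).
Proof.
apply: eq_bigr => i _; rewrite mxE mulr_sumr; apply: eq_bigr => j _.
by rewrite mxE; ring.
Qed.

Lemma aform_integrable v w : L2sob Omega v -> L2sob Omega w ->
  leb.-integrable Omega (fun x => (dot (w.2 x) (v.2 x *m (A x)^T))%:E).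
Proof.
move=> [_ sv] [_ sw].
under eq_fun do rewrite integrandE -sumEFin.
apply: integrable_sum => // i _.
under eq_fun do rewrite -sumEFin.
apply: integrable_sum => // j _.
have [B HB] := coef_bounded cA.
apply: (@ae_bounded_integrableM _ _ _ _ _ mO (fun x => A x i j) _ B).
- exact: (coef_measurable cA).
- by apply: filterS HB => x hx Ox; apply: hx.
- exact: (sqint_integrableM mO (sw i) (sv j)).
Qed.

Lemma aform_psd : psd_form (L2sob Omega) a.
Proof.
split.
- exact: L2sob_submodule.
- move=> u v su sv; congr fine; apply: ae_eq_integral => //.
  + by apply: measurable_int (aform_integrable su sv).
  + by apply: measurable_int (aform_integrable sv su).
  + apply: filterS (coef_sym cA) => x hx Ox; congr EFin.
    rewrite !integrandE exchange_big/=; apply: eq_bigr => i _; apply: eq_bigr => j _.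
    by rewrite -{1}(hx Ox) mxE; ring.
- move=> c u v w su sv sw.
  have iu := aform_integrable su sw; have iv := aform_integrable sv sw.
  rewrite /aform -RintegralZl// -RintegralD//; last exact: (integrableZl mO c iu).
  apply: eq_Rintegral => x _.
  rewrite (_ : (c *: u + v).2 x = c *: u.2 x + v.2 x)// mulmxDl -scalemxAl.
  by rewrite (formDr dot_psd)// (formZr dot_psd).
- move=> u su; have -> : 0 = \int[leb]_(x in Omega) 0 :> R by rewrite Rintegral_cst// mul0r.
  apply: ae_le_Rintegral => //; first exact: integrable0.
    exact: aform_integrable.
  apply: filterS (coef_elliptic cA) => x hx Ox.
  have /andP[h _] := hx Ox (u.2 x); apply: le_trans h.
  by rewrite mulr_ge0 ?sqr_ge0// ltW.
Qed.

Let stiffE v : L2sob Omega v ->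
  leb.-integrable Omega (fun x => (enorm (v.2 x) ^+ 2)%:E) /\
  stiff Omega v v = \int[leb]_(x in Omega) (enorm (v.2 x) ^+ 2).
Proof.
move=> [_ sv]; have [se e] := enorm_sqint mO sv; split.
  by have /sqintP[] := se.
by rewrite /stiff -e; apply: eq_Rintegral => x _; rewrite expr2.
Qed.

Lemma aform_coercive v : L2sob Omega v -> alpha * stiff Omega v v <= a v v.
Proof.
move=> sv; have [i2 ->] := stiffE sv; rewrite -RintegralZl//.
apply: ae_le_Rintegral => //; first exact: (integrableZl mO alpha i2).
  exact: aform_integrable.
by apply: filterS (coef_elliptic cA) => x hx Ox; have /andP[] := hx Ox (v.2 x).
Qed.

Lemma aform_bounded v : L2sob Omega v -> a v v <= beta * stiff Omega v v.
Proof.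
move=> sv; have [i2 ->] := stiffE sv; rewrite -RintegralZl//.
apply: ae_le_Rintegral => //; last first.
- by apply: filterS (coef_elliptic cA) => x hx Ox; have /andP[] := hx Ox (v.2 x).
- exact: (integrableZl mO beta i2).
- exact: aform_integrable.
Qed.

End EnergyForm.

Section SobolevEq.
Context {R : realType} {d : nat}.
Variable Omega : set 'rV[R]_d.
Hypothesis mO : measurable Omega.
Local Notation leb := (lebesgue_rV R d).
Implicit Types v w : @sobolev R d.
Local Notation eqv := (sob_eq Omega).

Lemma sob_eq_refl v : eqv v v.
Proof. by split; apply: aeW. Qed.

Lemma sob_eq_sym v w : eqv v w -> eqv w v.
Proof. by move=> [e1 e2]; split; [apply: filterS e1|apply: filterS e2] => x h /h. Qed.

Lemma sob_eq_trans u v w : eqv u v -> eqv v w -> eqv u w.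
Proof.
move=> [e1 e2] [f1 f2]; split; [apply: filterS2 e1 f1|apply: filterS2 e2 f2];
  by move=> x h k Ox; rewrite h ?k.
Qed.

Lemma sob_eqZD c v v' w w' : eqv v v' -> eqv w w' -> eqv (c *: v + w) (c *: v' + w').
Proof.
move=> [e1 e2] [f1 f2]; split; [apply: filterS2 e1 f1|apply: filterS2 e2 f2] => x hx kx Ox.
- rewrite (_ : (c *: v + w).1 x = c *: v.1 x + w.1 x)//.
  by rewrite (_ : (c *: v' + w').1 x = c *: v'.1 x + w'.1 x)// hx// kx.
- rewrite (_ : (c *: v + w).2 x = c *: v.2 x + w.2 x)//.
  by rewrite (_ : (c *: v' + w').2 x = c *: v'.2 x + w'.2 x)// hx// kx.
Qed.

Lemma sob_eqB v v' w w' : eqv v v' -> eqv w w' -> eqv (v - w) (v' - w').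
Proof.
move=> vv ww; have e x y : x - y = -1 *: y + x by rewrite scaleN1r addrC.
by rewrite !e; apply: sob_eqZD.
Qed.

Lemma sob_eq_mass v w : L2sob Omega v -> L2sob Omega w -> eqv v w ->
  mass Omega v v = mass Omega w w.
Proof. by move=> [[mv _] _] [[mw _] _] [e _]; apply: ipD_ae. Qed.

Lemma sob_eq_stiff v w : L2sob Omega v -> L2sob Omega w -> eqv v w ->
  stiff Omega v v = stiff Omega w w.
Proof.
move=> [_ sv] [_ sw] [_ e]; apply: eq_bigr => i _.
have ei : dcomp v i = dcomp w i %[ae leb in Omega].
  by apply: filterS e => x h Ox; rewrite /dcomp h.
by have [mv _] := sv i; have [mw _] := sw i; apply: ipD_ae.
Qed.

Lemma sob_eq_null v : L2sob Omega v -> mass Omega v v = 0 ->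
  stiff Omega v v = 0 -> eqv v 0.
Proof.
move=> [s1 s2] m0 st0; split.
  by apply/(ipD_eq0 mO).
have h i : dcomp v i = 0 %[ae leb in Omega].
  apply/(ipD_eq0 mO) => //.
  have P := sqint_psd leb mO.
  move: st0 => /eqP; rewrite /stiff psumr_eq0 => [/allP/(_ i)|j _]; last exact: (psd_ge0 P).
  by rewrite mem_index_enum => /(_ isT)/eqP.
have H : \forall x \ae leb, forall i, Omega x -> dcomp v i x = 0.
  by apply: filter_forall.
apply: filterS H => x hx Ox.
by apply/rowP => i; rewrite mxE; apply: hx.
Qed.

End SobolevEq.

Lemma within_continuous_lin {R : realType} {d : nat} (D : set 'rV[R]_d) (c : R)
  (p q : 'rV[R]_d -> R) : {within D, continuous p} -> {within D, continuous q} ->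
  {within D, continuous (fun x => c * p x + q x)}.
Proof.
move=> cp cq x.
have h1 : {for x, continuous (fun y : subspace D => c * p y)}.
  apply: (@continuousM R (subspace D) (cst c) p); first exact: cst_continuous.
  exact: cp.
by apply: (@continuousD R R^o (subspace D) (fun y => c * p y) q); [exact: h1|exact: cq].
Qed.

(** * Quasi-interpolation, corrector and error estimate *)

Section FiniteElements.
Context {R : realType} {d : nat}.
Variables (Omega : set 'rV[R]_d) (N : nat) (T : 'I_N -> 'M[R]_(d.+1, d)).
Variables (M alpha beta CI : R) (K : nat) (A : 'rV[R]_d -> 'M[R]_d).
Variable IH : @sobolev R d -> @sobolev R d.
Hypothesis mO : measurable Omega.
Hypothesis OM : Omega `<=` rV_box d M.
Hypothesis alpha0 : 0 < alpha.
Hypothesis alphabeta : alpha <= beta.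
Hypothesis cA : coefficient Omega alpha beta A.
Hypothesis d0 : (0 < d)%N.
Hypothesis cov : Omega `<=` \bigcup_i simplex (T i).
Hypothesis mT : forall i, measurable (simplex (T i)).
Hypothesis mN : forall i, measurable (element_patch T i).
Hypothesis NO : forall i, element_patch T i `<=` Omega.
Hypothesis ov : forall x, (#|[set i | `[< element_patch T i x >]]%SET| <= K)%N.
Hypothesis h0 : 0 < meshsize T.
Hypothesis qi : quasi_interpolation Omega T CI IH.
Implicit Types v w : @sobolev R d.
Local Notation V := (H10 Omega).
Local Notation W := (kerI Omega IH).
Local Notation VH := (P1space Omega T).
Local Notation a := (aform Omega A).
Local Notation m := (mass Omega).
Local Notation s := (stiff Omega).
Local Notation eqv := (sob_eq Omega).
Local Notation h := (meshsize T).

Let V_L2 v : V v -> L2sob Omega v. Proof. exact: H10_L2sob. Qed.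
Let sV : submodule V. Proof. exact: (H10_submodule mO OM). Qed.
Let mV : psd_form V m. Proof. exact: psd_form_sub (mass_psd mO) sV V_L2. Qed.
Let stV : psd_form V s. Proof. exact: psd_form_sub (stiff_psd mO) sV V_L2. Qed.
Let aV : psd_form V a. Proof. exact: psd_form_sub (aform_psd mO alpha0 cA) sV V_L2. Qed.

Let VI v : V v -> V (IH v). Proof. by move=> Vv; case: (qi_range qi Vv). Qed.

Let beta0 : 0 < beta. Proof. exact: lt_le_trans alphabeta. Qed.

(** The inequality itself makes [c * Num.sqrt b'] nonnegative, so it can be squared whatever the
    sign of [c], in particular for [CI]. *)
Let sqr_sub (b b' c : R) : 0 <= b -> 0 <= b' ->
  Num.sqrt b <= c * Num.sqrt b' -> b <= c ^+ 2 * b'.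
Proof.
move=> b0 b'0 H; have c0 : 0 <= c * Num.sqrt b' := le_trans (sqrtr_ge0 b) H.
rewrite -{1}(sqr_sqrtr b0) -[b' in leRHS](sqr_sqrtr b'0) -exprMn.
by rewrite lerXn2r// nnegrE// sqrtr_ge0.
Qed.

(** Local bounds are squared and summed: the simplices cover [Omega], and each point lies in at most
    [K] patches. The two nonnegative summands of [qi_H1_stable] are bounded separately. *)
Let stable v : V v ->
  m (v - IH v) (v - IH v) <= (h * CI) ^+ 2 * (K%:R * s v v) /\
  s (IH v) (IH v) <= CI ^+ 2 * (K%:R * s v v) /\
  m (IH v) (IH v) <= CI ^+ 2 * (K%:R * m v v).
Proof.
move=> Vv; have sv := V_L2 Vv; have sI := V_L2 (VI Vv).
have sd : L2sob Omega (v - IH v) by apply: V_L2; apply: (psdB mV) => //; apply: VI.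
have mOT i : measurable (Omega `&` simplex (T i)) by apply: measurableI.
have subT w i : L2sob Omega w -> L2sob (Omega `&` simplex (T i)) w.
  by apply: L2sobS => //; apply: subIsetl.
have subN w i : L2sob Omega w -> L2sob (element_patch T i) w.
  by apply: L2sobS => //; apply: NO.
have geT i w : L2sob Omega w ->
    ((seminorm (mass (Omega `&` simplex (T i))) w)%:E <= L2norm (simplex (T i)) w.1)%E /\
    ((seminorm (stiff (Omega `&` simplex (T i))) w)%:E <= gradnorm (simplex (T i)) w)%E.
  move=> sw; rewrite -L2norm_mass// -?gradnorm_stiff//; try exact: subT.
  by split; apply: L2norm_subset; apply: subIsetr.
have stab i := qi_H1_stable qi i Vv.
have e1 i : mass (Omega `&` simplex (T i)) (v - IH v) (v - IH v) <=
    (h * CI) ^+ 2 * stiff (element_patch T i) v v.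
  apply: sqr_sub => //.
  - exact: (psd_ge0 (mass_psd (mOT i)) (subT _ i sd)).
  - exact: (psd_ge0 (stiff_psd (mN i)) (subN _ i sv)).
  have := stab i; rewrite (gradnorm_stiff (mN i) (subN _ i sv)) => /(le_trans _) H.
  have : (h^-1%:E * (seminorm (mass (Omega `&` simplex (T i))) (v - IH v))%:E <=
      CI%:E * (seminorm (stiff (element_patch T i)) v)%:E)%E.
    apply: H; apply: (@le_trans _ _ (h^-1%:E * L2norm (simplex (T i)) (v - IH v)%R.1)%E).
      by apply: lee_wpmul2l; [rewrite lee_fin invr_ge0 ltW|have [] := geT i _ sd].
    by rewrite leeDl// L2norm_ge0.
  by rewrite -!EFinM lee_fin ler_pdivrMl// mulrA.
have e2 i : stiff (Omega `&` simplex (T i)) (IH v) (IH v) <=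
    CI ^+ 2 * stiff (element_patch T i) v v.
  apply: sqr_sub => //.
  - exact: (psd_ge0 (stiff_psd (mOT i)) (subT _ i sI)).
  - exact: (psd_ge0 (stiff_psd (mN i)) (subN _ i sv)).
  have := stab i; rewrite (gradnorm_stiff (mN i) (subN _ i sv)) => /(le_trans _) H.
  rewrite -lee_fin EFinM; apply: H; apply: (le_trans (geT i _ sI).2).
  by rewrite leeDr// mule_ge0 ?L2norm_ge0// lee_fin invr_ge0 ltW.
have e3 i : mass (Omega `&` simplex (T i)) (IH v) (IH v) <=
    CI ^+ 2 * mass (element_patch T i) v v.
  apply: sqr_sub => //.
  - exact: (psd_ge0 (mass_psd (mOT i)) (subT _ i sI)).
  - exact: (psd_ge0 (mass_psd (mN i)) (subN _ i sv)).
  have := qi_L2_stable qi i Vv; rewrite (L2norm_mass (mN i) (subN _ i sv)) => H.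
  by rewrite -lee_fin EFinM; apply: le_trans H; exact: (geT i _ sI).1.
split; [|split].
- apply: le_trans (mass_cover mO mT cov sd) _.
  apply: (@le_trans _ _ (\sum_i (h * CI) ^+ 2 * stiff (element_patch T i) v v)).
    by apply: ler_sum => i _; apply: e1.
  rewrite -mulr_sumr; apply: ler_wpM2l; first exact: sqr_ge0.
  exact: stiff_overlap.
- apply: le_trans (stiff_cover mO mT cov sI) _.
  apply: (@le_trans _ _ (\sum_i CI ^+ 2 * stiff (element_patch T i) v v)).
    by apply: ler_sum => i _; apply: e2.
  rewrite -mulr_sumr; apply: ler_wpM2l; first exact: sqr_ge0.
  exact: stiff_overlap.
- apply: le_trans (mass_cover mO mT cov sI) _.
  apply: (@le_trans _ _ (\sum_i CI ^+ 2 * mass (element_patch T i) v v)).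
    by apply: ler_sum => i _; apply: e3.
  rewrite -mulr_sumr; apply: ler_wpM2l; first exact: sqr_ge0.
  exact: mass_overlap.
Qed.

Let sqrt_le (x y c : R) : 0 <= c -> 0 <= y -> x <= c ^+ 2 * y ->
  Num.sqrt x <= c * Num.sqrt y.
Proof.
move=> c0' y0 xy; rewrite -(ger0_norm c0') -sqrtr_sqr -sqrtrM ?sqr_ge0//.
by rewrite ler_sqrt// mulr_ge0// sqr_ge0.
Qed.

Definition stab_const : R := CI ^+ 2 * K%:R.
Local Notation c2 := stab_const.

Lemma stab_const_ge0 : 0 <= c2. Proof. by rewrite mulr_ge0// sqr_ge0. Qed.

Let s_le_a v : V v -> s v v <= alpha^-1 * a v v.
Proof.
by move=> Vv; rewrite ler_pdivlMl//; exact: (aform_coercive mO cA (V_L2 Vv)).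
Qed.

Let a_le_s v : V v -> a v v <= beta * s v v.
Proof. by move=> Vv; apply: (aform_bounded mO cA (V_L2 Vv)). Qed.

Let V0 : V 0. Proof. exact: (psd0 mV). Qed.

Let eq0 v : V v -> m v v = 0 -> s v v = 0 -> eqv v 0.
Proof. by move=> /V_L2; apply: sob_eq_null. Qed.

Let I0 : eqv (IH 0) 0.
Proof.
have [_ [h1 h2]] := stable V0; apply: eq0; first exact: VI.
- apply/eqP; rewrite eq_le (psd_ge0 mV (VI V0)) andbT.
  by apply: le_trans h2 _; rewrite (form0l mV V0) !mulr0.
- apply/eqP; rewrite eq_le (psd_ge0 stV (VI V0)) andbT.
  by apply: le_trans h1 _; rewrite (form0l stV V0) !mulr0.
Qed.

Let sW : submodule W.
Proof.
split; first by split; [exact: V0|exact: I0].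
move=> c u v [Vu Iu] [Vv Iv]; split; first exact: (psdZD mV).
apply: sob_eq_trans (qi_linear qi c Vu Vv) _.
by have := sob_eqZD c Iu Iv; rewrite scaler0 addr0.
Qed.

Let WV w : W w -> V w. Proof. by case. Qed.

Let VHV v : VH v -> V v. Proof. by case. Qed.

Let sVH : submodule VH.
Proof.
split.
  split => //; exists (fun _ => 0); split.
  - exact: cst_continuous.
  - by move=> i; exists 0, 0 => x _; rewrite /dot big1 ?addr0// => j _; rewrite mxE mul0r.
  - exact: aeW.
move=> c u v [Vu [p [cp ap up]]] [Vv [q [cq aq vq]]]; split; first exact: (psdZD mV).
exists (fun x => c * p x + q x); split.
- exact: within_continuous_lin.
- move=> i; have [a1 [b1 H1]] := ap i; have [a2 [b2 H2]] := aq i.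
  exists (c *: a1 + a2), (c * b1 + b2) => x Tx.
  by rewrite H1// H2// (psd_lin dot_psd)//; ring.
- by apply: filterS2 up vq => x hx kx Ox; rewrite -hx// -kx.
Qed.

Let IVH v : V v -> VH (IH v). Proof. by move=> Vv; exact: (qi_range qi Vv). Qed.

Let IB v w : V v -> V w -> eqv (IH (v - w)) (IH v - IH w).
Proof.
move=> Vv Vw; have e x y : x - y = -1 *: y + x by rewrite scaleN1r addrC.
by rewrite !e; exact: (qi_linear qi (-1) Vw Vv).
Qed.

Let IW v : V v -> W (v - IH v).
Proof.
move=> Vv; have VIv := VI Vv; split; first exact: (psdB mV).
apply: sob_eq_trans (IB Vv VIv) _.
have := sob_eqB (sob_eq_refl Omega (IH v)) (qi_projection qi Vv).
by rewrite subrr.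
Qed.

(** By surjectivity [v] is some [IH w] almost everywhere; [qi_compat] allows the replacement under
    [IH], and the projection property concludes. *)
Let I_VH v : VH v -> eqv (IH v) v.
Proof.
move=> VHv; have [w Vw Iw] := qi_surjective qi VHv.
have VIw := VI Vw; have Vv := VHV VHv.
apply: sob_eq_trans (qi_compat qi Vv VIw (sob_eq_sym Iw)) _.
exact: sob_eq_trans (qi_projection qi Vw) Iw.
Qed.

Definition W_const : R := h * Num.sqrt (c2 / alpha).
Definition stab_energy_const : R := Num.sqrt (beta * c2 / alpha).

(** On [W], [w] and [w - IH w] agree almost everywhere, so the approximation bound of [IH] controls
    [w] itself. *)
Let W_small w : W w -> seminorm m w <= W_const * seminorm a w.
Proof.
move=> [Vw Iw]; have Vd := psdB mV Vw (VI Vw).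
apply: sqrt_le; first by rewrite mulr_ge0 ?sqrtr_ge0// ltW.
  exact: (psd_ge0 aV).
have <- : m (w - IH w) (w - IH w) = m w w.
  apply: (sob_eq_mass mO (V_L2 Vd) (V_L2 Vw)).
  by have := sob_eqB (sob_eq_refl Omega w) Iw; rewrite subr0.
have [h1 _] := stable Vw; apply: le_trans h1 _.
rewrite /W_const [leRHS](_ : _ = h ^+ 2 * (c2 / alpha) * a w w); last first.
  by rewrite exprMn sqr_sqrtr// divr_ge0 ?stab_const_ge0// ltW.
have -> : h ^+ 2 * (c2 / alpha) * a w w = (h * CI) ^+ 2 * (K%:R * (alpha^-1 * a w w)).
  by rewrite /stab_const exprMn; ring.
by rewrite !ler_wpM2l ?sqr_ge0//; apply: s_le_a.
Qed.

(** [IH (v - w)] agrees with [v]; the factor [beta / alpha] is the price of passing from energy to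
    gradients and back. *)
Let I_stable v w : VH v -> W w ->
  seminorm a v <= stab_energy_const * seminorm a (v - w).
Proof.
move=> VHv Ww; have Vv := VHV VHv; have [Vw Iw] := Ww.
have Vd := psdB mV Vv Vw.
have E : eqv (IH (v - w)) v.
  apply: sob_eq_trans (IB Vv Vw) _.
  by have := sob_eqB (I_VH VHv) Iw; rewrite subr0.
apply: sqrt_le; first exact: sqrtr_ge0.
  exact: (psd_ge0 aV).
rewrite /stab_energy_const sqr_sqrtr; last first.
  exact: (divr_ge0 (mulr_ge0 (ltW beta0) stab_const_ge0) (ltW alpha0)).
apply: le_trans (a_le_s Vv) _.
rewrite -(sob_eq_stiff mO (V_L2 (VI Vd)) (V_L2 Vv) E).
have [_ [h1 _]] := stable Vd.
have -> : beta * c2 / alpha * a (v - w) (v - w) =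
   beta * (CI ^+ 2 * (K%:R * (alpha^-1 * a (v - w) (v - w)))).
  by rewrite /stab_const; ring.
rewrite ler_pM2l//; apply: le_trans h1 _.
by rewrite !ler_wpM2l ?sqr_ge0//; apply: s_le_a.
Qed.

(** Coercivity passes from energy to gradients, Friedrichs from gradients to masses; boundedness of
    [a] carries convergence back to the energy. *)
Let V_complete (x : nat -> @sobolev R d) : (forall n, V (x n)) -> cauchy_for a x ->
  exists2 l, V l & [/\ converges_for a x l, converges_for m x l & converges_for s x l].
Proof.
move=> Vx ca.
have cs : cauchy_for s x.
  move=> e e0; have [n Hn] := ca (alpha * e) (mulr_gt0 alpha0 e0).
  exists n => i j ni nj; have Vd := psdB mV (Vx i) (Vx j).
  by apply: le_lt_trans (s_le_a Vd) _; rewrite ltr_pdivrMl//; apply: Hn.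
have cm : cauchy_for m x.
  have M1 : 0 < (2 * M) ^+ 2 + 1 by rewrite ltr_wpDl ?sqr_ge0.
  move=> e e0; have [n Hn] := cs (e / ((2 * M) ^+ 2 + 1)) (divr_gt0 e0 M1).
  exists n => i j ni nj; have Vd := psdB mV (Vx i) (Vx j).
  apply: le_lt_trans (friedrichs mO OM (Ordinal d0) Vd) _.
  have := Hn _ _ ni nj; rewrite ltr_pdivlMr// mulrDr mulr1 mulrC => H.
  by apply: le_lt_trans H; rewrite lerDl (psd_ge0 stV).
have [l Vl [lm ls]] := H10_complete mO OM Vx cm cs.
exists l => //; split => // e e0.
have [n Hn] := ls _ (divr_gt0 e0 beta0); exists n => i ni.
have Vd := psdB mV (Vx i) Vl.
by apply: le_lt_trans (a_le_s Vd) _; rewrite mulrC -ltr_pdivlMr//; apply: Hn.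
Qed.

(** The kernel is closed: [IH (x n - l)] agrees with [- IH l], so stability bounds [IH l] by
    distances that tend to 0. *)
Let W_complete (x : nat -> @sobolev R d) : (forall n, W (x n)) -> cauchy_for a x ->
  exists2 l, W l & converges_for a x l.
Proof.
move=> Wx ca; have Vx n := WV (Wx n).
have [l Vl [la lm ls]] := V_complete Vx ca; exists l => //; split => //.
have c20 := stab_const_ge0.
have c21 : 0 < c2 + 1 by rewrite ltr_wpDl.
have VIl := VI Vl.
have E n : eqv (IH (x n - l)) (- IH l).
  apply: sob_eq_trans (IB (Vx n) Vl) _.
  by have := sob_eqB (Wx n).2 (sob_eq_refl Omega (IH l)); rewrite sub0r.
have negE (b : sobolev -> sobolev -> R) : psd_form V b -> b (- IH l) (- IH l) = b (IH l) (IH l).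
  move=> bV; rewrite -scaleN1r (formZl bV (-1) VIl (psdZ bV (-1) VIl)).
  by rewrite (formZr bV (-1) VIl VIl) mulrA mulrNN mulr1 mul1r.
have VNl : V (- IH l) by rewrite -scaleN1r; apply: (psdZ mV).
have small (b : sobolev -> sobolev -> R) : psd_form V b -> converges_for b x l ->
    (forall n, b (IH l) (IH l) <= CI ^+ 2 * (K%:R * b (x n - l) (x n - l))) -> b (IH l) (IH l) = 0.
  move=> bV cb Hb; apply/eqP; rewrite eq_le (psd_ge0 bV)// andbT.
  apply/ler_addgt0Pr => e e0; rewrite add0r.
  have [n Hn] := cb _ (divr_gt0 e0 c21).
  have Vd := psdB bV (Vx n) Vl.
  have := Hn n (leqnn _); rewrite ltr_pdivlMr// mulrDr mulr1 mulrC => /ltW H.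
  apply: le_trans (Hb n) _; rewrite mulrA; apply: le_trans H.
  by rewrite lerDl (psd_ge0 bV).
apply: eq0 => //.
- apply: (small _ mV lm) => n; have Vd := psdB mV (Vx n) Vl.
  rewrite -(negE _ mV) -(sob_eq_mass mO (V_L2 (VI Vd)) (V_L2 VNl) (E n)).
  by have [_ [_]] := stable Vd.
- apply: (small _ stV ls) => n; have Vd := psdB mV (Vx n) Vl.
  rewrite -(negE _ stV) -(sob_eq_stiff mO (V_L2 (VI Vd)) (V_L2 VNl) (E n)).
  by have [_ []] := stable Vd.
Qed.

Let aW : psd_form W a. Proof. exact: psd_form_sub aV sW WV. Qed.

(** Riesz on [W], for the functional [a v], supplies the witness that [xget] needs. *)
Lemma corrector_spec v : V v -> W (corrector Omega A IH v) /\
  forall w, W w -> a w (v - corrector Omega A IH v) = 0.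
Proof.
move=> Vv.
have [z Wz zE] : exists2 z, W z & forall w, W w -> a z w = a v w.
  apply: (riesz_representation (k := a v v) aW W_complete).
  - move=> c x y /WV Vx /WV Vy.
    by rewrite (formDr aV (psdZ aV c Vx) Vy Vv) (formZr aV c Vx Vv).
  - by move=> w /WV Vw; apply: (form_CS2 aV).
suff ex : exists c, W c /\ forall w, W w -> a w (v - c) = 0.
  by have := xgetPex 0 ex.
exists z; split => // w Ww; have Vw := WV Ww; have Vz := WV Wz.
by rewrite (formBr aV)// (psd_sym aV Vw Vv) (psd_sym aV Vw Vz) zE// subrr.
Qed.

(** Riesz on all of [V]; Cauchy-Schwarz, Friedrichs and coercivity bound the load in energy, whence
    the constant [k]. *)
Lemma sol_spec (g : 'rV[R]_d -> R) : sqint (lebesgue_rV R d) Omega g ->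
  weak_solution Omega A g (sol Omega A g).
Proof.
move=> sg; have P := sqint_psd (lebesgue_rV R d) mO.
suff ex : exists u, weak_solution Omega A g u by have := xgetPex 0 ex.
have sv v : V v -> sqint (lebesgue_rV R d) Omega v.1 by move=> /V_L2[].
have [z Vz zE] : exists2 z, V z & forall w, V w -> a z w = load Omega g w.
  apply: (riesz_representation
    (k := ipD (lebesgue_rV R d) Omega g g * ((2 * M) ^+ 2 * alpha^-1)) aV).
  - by move=> x Vx ca; have [l Vl [la _ _]] := V_complete Vx ca; exists l.
  - move=> c x y Vx Vy; have sx := sv _ Vx; have sy := sv _ Vy.
    have := formDr P (psdZ P c sx) sy sg.
    by rewrite (formZr P c sx sg).
  - move=> w Vw; have sw := sv _ Vw.
    apply: le_trans (form_CS2 P sg sw) _; rewrite -mulrA.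
    apply: ler_wpM2l; first exact: (psd_ge0 P).
    apply: le_trans (friedrichs mO OM (Ordinal d0) Vw) _.
    rewrite -[leRHS]mulrA; apply: ler_wpM2l; first exact: sqr_ge0.
    exact: s_le_a.
by exists z; split.
Qed.

Local Notation ip := (ipD (lebesgue_rV R d) Omega).
Local Notation nrm := (seminorm m).
Local Notation K1 := (1 + Num.sqrt c2).

Let K1_gt0 : 0 < K1. Proof. by rewrite ltr_wpDr ?sqrtr_ge0. Qed.

(** As [IH] fixes [vH], [v - IH v] agrees with [(v - vH) - IH (v - vH)], and [IH] has L^2 bound
    [sqrt c2]. *)
Lemma best_approximation v vH : V v -> VH vH ->
  nrm (v - IH v) <= K1 * nrm (v - vH).
Proof.
move=> Vv VHvH; have VvH := VHV VHvH; have Vd := psdB mV Vv VvH.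
have VId := VI Vd; have VIv := VI Vv.
have E : eqv (v - IH v) ((v - vH) - IH (v - vH)).
  have := sob_eqB (sob_eq_refl Omega (v - vH)) (IB Vv VvH).
  move=> /sob_eq_sym; apply: sob_eq_trans.
  have := sob_eqB (sob_eq_refl Omega (v - vH)) (sob_eqB (sob_eq_refl Omega (IH v)) (I_VH VHvH)).
  move=> /sob_eq_sym; apply: sob_eq_trans.
  by rewrite opprB addrA subrK; exact: sob_eq_refl.
rewrite {1}/seminorm (sob_eq_mass mO (V_L2 (psdB mV Vv VIv)) (V_L2 (psdB mV Vd VId)) E).
apply: le_trans (seminormB mV Vd VId) _.
rewrite mulrDl mul1r lerD2l.
apply: sqrt_le; first exact: sqrtr_ge0.
  exact: (psd_ge0 mV).
rewrite sqr_sqrtr ?stab_const_ge0// /stab_const -mulrA.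
by have [_ []] := stable Vd.
Qed.

(** The last summand is [(1 + K ^ 2) p ^ 2 / h ^ 2] in the notation of [abstract_L2_estimate]. *)
Definition error_const : R :=
  2 * K1 + (1 + stab_energy_const ^+ 2) * (c2 / alpha).

Lemma error_const_gt0 : 0 < error_const.
Proof.
apply: ltr_pwDl; first exact: mulr_gt0.
by rewrite mulr_ge0 ?addr_ge0 ?sqr_ge0 ?divr_ge0 ?stab_const_ge0// ltW.
Qed.

(** [wc] stands for a finite [wcba]. The last hypothesis is its sup-inf in elementary form: an [x]
    below all ratios for one [g] is below their infimum, hence below the supremum over [g]. *)
Lemma discrete_solution_error (f : 'rV[R]_d -> R) u uH (wc : R) :
  sqint (lebesgue_rV R d) Omega f -> 0 < ip f f ->
  weak_solution Omega A f u -> discrete_solution Omega T A IH f uH ->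
  (forall g x, sqint (lebesgue_rV R d) Omega g -> 0 < ip g g ->
    (forall vH, VH vH -> x * Num.sqrt (ip g g) <= nrm (sol Omega A g - vH)) ->
    x <= wc) ->
  nrm (u - uH) <= error_const * (h ^+ 2 + wc) * Num.sqrt (ip f f).
Proof.
move=> sf f0 [Vu uE] [VHuH uHE] Hwc.
have P := sqint_psd (lebesgue_rV R d) mO.
have sv v : V v -> sqint (lebesgue_rV R d) Omega v.1 by move=> /V_L2[].
pose nf := Num.sqrt (ip f f); have nf0 : 0 < nf by rewrite sqrtr_gt0.
have [Vuf ufE] := sol_spec sf.
(* [u] is a given solution, [sol Omega A f] a chosen one; their difference has zero energy, hence
   zero mass. *)
have solE : nrm (u - sol Omega A f) = 0.
  have Vd := psdB mV Vu Vuf.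
  have a0 : a (u - sol Omega A f) (u - sol Omega A f) = 0.
    by rewrite (formBl aV Vu Vuf Vd) uE// ufE// subrr.
  apply/eqP; rewrite sqrtr_eq0; apply: le_trans (friedrichs mO OM (Ordinal d0) Vd) _.
  rewrite mulr_ge0_le0 ?sqr_ge0//; apply: le_trans (s_le_a Vd) _.
  by rewrite a0 mulr0.
have VIu := VI Vu.
have uIu : nrm (u - IH u) <= K1 * (wc * nf).
  have : nrm (u - IH u) / (K1 * nf) <= wc.
    apply: (Hwc f _ sf f0) => vH VHvH; have VvH := VHV VHvH.
    rewrite -/nf invfM mulrA mulfVK ?gt_eqF// ler_pdivrMr//.
    rewrite [leRHS]mulrC; apply: le_trans (best_approximation Vu VHvH) _.
    rewrite (ler_pM2l K1_gt0).
    have -> : u - vH = (u - sol Omega A f) + (sol Omega A f - vH) by rewrite addrA subrK.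
    apply: le_trans (seminormD mV (psdB mV Vu Vuf) (psdB mV Vuf VvH)) _.
    by rewrite solE add0r.
  by rewrite ler_pdivrMr ?mulr_gt0// => H; rewrite mulrCA.
have VuH := VHV VHuH; have Ve := psdB mV VuH VIu.
set e := uH - IH u in Ve.
have ip_e : ip e.1 e.1 = m e e by [].
have n_e : nrm e <= K1 * (wc * nf) + (1 + stab_energy_const ^+ 2) * W_const ^+ 2 * nf.
  have wc0 : 0 <= wc.
    apply: (Hwc f _ sf f0) => vH _; rewrite mul0r; exact: seminorm_ge0.
  (* [e] serves as load of the dual problem: [wcba] ranges over nonzero loads only, and the estimate
     is divided by [|e|]. *)
  have [e0|e0] := eqVneq (m e e) 0.
    rewrite {1}/seminorm e0 sqrtr0; apply: addr_ge0.
      by apply: mulr_ge0 (ltW K1_gt0) (mulr_ge0 wc0 (ltW nf0)).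
    by rewrite mulr_ge0 ?(ltW nf0)// mulr_ge0 ?sqr_ge0// addr_ge0 ?sqr_ge0.
  have {}e0 : 0 < m e e by have := psd_ge0 mV Ve; rewrite le_eqVlt eq_sym (negbTE e0).
  have ne0 : 0 < nrm e by rewrite sqrtr_gt0.
  have [Vz zE] := sol_spec (sv _ Ve).
  set z := sol Omega A e.1 in Vz zE.
  have zIz : nrm (z - IH z) <= K1 * (wc * nrm e).
    have : nrm (z - IH z) / (K1 * nrm e) <= wc.
      apply: (Hwc e.1 _ (sv _ Ve) e0) => vH VHvH.
      rewrite -[Num.sqrt (ip _ _)]/(nrm e) invfM mulrA mulfVK ?gt_eqF// ler_pdivrMr//.
      by rewrite [leRHS]mulrC; apply: best_approximation.
    by rewrite ler_pdivrMr ?mulr_gt0// => H; rewrite mulrCA.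
  have W0 : 0 <= W_const by rewrite mulr_ge0 ?sqrtr_ge0// ltW.
  have est : nrm e ^+ 2 <= nf * (nrm (z - IH z) +
      (1 + stab_energy_const ^+ 2) * W_const ^+ 2 * nrm e).
    have CW v : V v -> W (corrector Omega A IH v) by case/corrector_spec.
    have Corth v w : V v -> W w -> a w (v - corrector Omega A IH v) = 0.
      by case/corrector_spec => _ H; exact: H.
    have linF c x y : V x -> V y ->
        load Omega f (c *: x + y) = c * load Omega f x + load Omega f y.
      move=> Vx Vy; have sx := sv _ Vx; have sy := sv _ Vy.
      by have := formDr P (psdZ P c sx) sy sf; rewrite (formZr P c sx sf).
    have bndF v : V v -> `|load Omega f v| <= nf * nrm v.
      by move=> Vv; apply: (form_CS P sf (sv _ Vv)).
    exact: (abstract_L2_estimate aV mV sW sVH WV VHV W0 (sqrtr_ge0 _) (ltW nf0)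
      W_small IVH IW I_stable CW Corth linF bndF Vu uE VHuH uHE Vz zE).
  rewrite -(ler_pM2r ne0) -expr2; apply: le_trans est _.
  rewrite [leRHS]mulrDl [leLHS]mulrDr; apply: lerD.
    apply: le_trans (ler_wpM2l (ltW nf0) zIz) _.
    by rewrite le_eqVlt; apply/orP; left; apply/eqP; ring.
  by rewrite le_eqVlt; apply/orP; left; apply/eqP; ring.
have wc0 : 0 <= wc.
  apply: (Hwc f _ sf f0) => vH _; rewrite mul0r; exact: seminorm_ge0.
have -> : u - uH = (u - IH u) - e by rewrite /e opprB addrA subrK.
apply: le_trans (seminormB mV (psdB mV Vu VIu) Ve) _.
apply: le_trans (lerD uIu n_e) _; rewrite -/nf.
have Wsq : W_const ^+ 2 = h ^+ 2 * (c2 / alpha).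
  by rewrite /W_const exprMn sqr_sqrtr// divr_ge0 ?stab_const_ge0// ltW.
rewrite Wsq.
have h20 : 0 <= h ^+ 2 by apply: sqr_ge0.
have q0 : 0 <= (1 + stab_energy_const ^+ 2) * (c2 / alpha).
  by rewrite mulr_ge0 ?addr_ge0 ?sqr_ge0 ?divr_ge0 ?stab_const_ge0// ltW.
have -> : (1 + stab_energy_const ^+ 2) * (h ^+ 2 * (c2 / alpha)) * nf =
  (1 + stab_energy_const ^+ 2) * (c2 / alpha) * (h ^+ 2 * nf) by ring.
rewrite /error_const; move: q0 (h ^+ 2) h20 K1_gt0.
move: ((1 + stab_energy_const ^+ 2) * (c2 / alpha)) (1 + Num.sqrt c2) => q k q0 t t0 k0.
have H1 : 0 <= k * (t * nf) by apply: mulr_ge0 (ltW k0) (mulr_ge0 t0 (ltW nf0)).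
have H2 : 0 <= q * (wc * nf) by apply: mulr_ge0 => //; apply: mulr_ge0 => //; exact: ltW.
rewrite -subr_ge0.
have -> : (2 * k + q) * (t + wc) * nf - (k * (wc * nf) + (k * (wc * nf) + q * (t * nf))) =
   2 * (k * (t * nf)) + q * (wc * nf) by ring.
by rewrite addr_ge0// mulr_ge0.
Qed.

End FiniteElements.

Theorem proposition5 (R : realType) (d : nat) (hd : (1 <= d <= 3)%N)
    (Omega : set 'rV[R]_d) (hOmega : lipschitz_polytope Omega)
    (alpha beta : R) (halpha : 0 < alpha) (hbeta : alpha <= beta)
    (CI sigma kappa : R) :
  exists C : R, 0 < C /\
    forall (A : 'rV[R]_d -> 'M[R]_d) (N : nat)
      (T : 'I_N -> 'M[R]_(d.+1, d)) (IH : sobolev -> sobolev),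
      coefficient Omega alpha beta A ->
      triangulation Omega T ->
      shape_regular T sigma ->
      quasi_uniform T kappa ->
      quasi_interpolation Omega T CI IH ->
    forall (f : 'rV[R]_d -> R) (u uH : sobolev),
      L2 Omega f -> nonzero_on Omega f ->
      weak_solution Omega A f u ->
      discrete_solution Omega T A IH f uH ->
      (L2norm Omega (u - uH)%R.1 / L2norm Omega f
       <= C%:E * ((meshsize T ^+ 2)%:E + wcba Omega T A))%E.
Proof.
have d0 : (0 < d)%N by case/andP: hd.
have [oO lO _] := hOmega.
have [M OM] := lipschitz_polytope_bounded hOmega.
have mO : measurable Omega by apply: open_measurable_rV.
(* Depends on [d], [sigma] and [kappa] alone, so the constant can be fixed before the coefficient
   and the mesh. *)
pose K := @overlap_bound R d sigma kappa.
exists (error_const alpha beta CI K); split; first exact: error_const_gt0.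
move=> A N T IH cA triT srT quT qi f u uH L2f nzf usol uHsol.
have P := sqint_psd (lebesgue_rV R d) mO.
have ip_gt0 g : sqint (lebesgue_rV R d) Omega g -> nonzero_on Omega g ->
    0 < ipD (lebesgue_rV R d) Omega g g.
  move=> sg nzg; rewrite lt_def (psd_ge0 P sg) andbT; apply/eqP => g0; apply: nzg.
  exact/(ipD_eq0 mO sg).
have sf : sqint (lebesgue_rV R d) Omega f by apply/L2P.
have f0 := ip_gt0 f sf nzf.
have cov : Omega `<=` \bigcup_i simplex (T i).
  by rewrite (tri_cover triT); exact: subset_closure.
have mT i : measurable (simplex (T i)) := simplex_measurable (tri_nondegenerate triT i).
have mN i := @element_patch_measurable R d N T i.
have NO i : element_patch T i `<=` Omega := element_patch_sub triT oO lO.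
have ov := patch_overlap d0 triT srT quT.
(* A nonzero load forces [Omega] to be nonempty, hence the mesh to have an element. *)
have h0 : 0 < meshsize T.
  have [[x Ox]|nO] := pselect (Omega !=set0).
    by have [i _ _] := cov x Ox; exact: (meshsize_gt0 d0 triT i).
  by exfalso; apply: nzf; apply: aeW => x Ox; exfalso; apply: nO; exists x.
have [Vu _] := usol; have [[VuH _] _] := uHsol.
have Hsub := H10_submodule mO OM.
have Lsol g vH : sqint (lebesgue_rV R d) Omega g -> P1space Omega T vH ->
    L2sob Omega (sol Omega A g - vH).
  move=> sg [VvH _]; apply: (psdB (mass_psd mO)); last exact: H10_L2sob.
  by have [+ _] := sol_spec mO OM halpha hbeta cA d0 sg; exact: H10_L2sob.
have Lu : L2sob Omega (u - uH).
  by apply: (psdB (mass_psd mO)); exact: H10_L2sob.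
have f0' : 0 < Num.sqrt (ipD (lebesgue_rV R d) Omega f f) by rewrite sqrtr_gt0.
rewrite (L2norm_mass mO Lu) (L2norm_ip mO sf).
have le_wcba g x : sqint (lebesgue_rV R d) Omega g ->
    0 < ipD (lebesgue_rV R d) Omega g g ->
    (forall vH, P1space Omega T vH -> x * Num.sqrt (ipD (lebesgue_rV R d) Omega g g) <=
       seminorm (mass Omega) (sol Omega A g - vH)) ->
    (x%:E <= wcba Omega T A)%E.
  move=> sg g0 H; have g0' : 0 < Num.sqrt (ipD (lebesgue_rV R d) Omega g g) by rewrite sqrtr_gt0.
  have nzg : nonzero_on Omega g by move=> /(ipD_eq0 mO sg) e; rewrite e ltxx in g0.
  apply: (@le_trans _ _ (ereal_inf [set (L2norm Omega (sol Omega A g - vH)%R.1 /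
      L2norm Omega g)%E | vH in P1space Omega T])).
    apply: le_ereal_inf_tmp => _ [vH VHvH <-].
    rewrite (L2norm_mass mO (Lsol g vH sg VHvH)) (L2norm_ip mO sg) inver gt_eqF//.
    rewrite -EFinM lee_fin ler_pdivlMr//; exact: H.
  by apply: ereal_sup_ubound; exists g => //; split => //; apply/L2P.
have wc0 : (0 <= wcba Omega T A)%E.
  by apply: (le_wcba f 0) => // vH _; rewrite mul0r; exact: seminorm_ge0.
have C0 := error_const_gt0 beta CI K halpha.
(* If [wcba] is infinite, so is the right side; [-oo] is excluded by [wc0]. *)
case wE : (wcba Omega T A) le_wcba wc0 => [w| |] le_wcba wc0 //; last first.
  by rewrite addey// mulry gtr0_sg// mul1e leey.
rewrite inver gt_eqF// -EFinD -!EFinM lee_fin ler_pdivrMr//.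
apply: (discrete_solution_error mO OM halpha hbeta cA d0 cov mT mN NO ov h0 qi sf f0 usol uHsol).
by move=> g x sg g0 H; rewrite -lee_fin; apply: (le_wcba g).
Qed.
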